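(* In the terminology of the context, the following hold. (1) Each of $G_{6.10}^{a=0}/\Gamma_{2\pi}$ and $(G_{5.14}^{0}\times\mathbb{R})/\Gamma_{2\pi}$ admits invariant symplectic forms, and also not invariant symplectic forms, which are not half-flat. (2) Let $p\in\mathbb{R}$ and $r=\frac{r_1}{r_2}\in\mathbb{Q}\setminus\{0\}$ ($r_1,r_2$ integers, $r_2>0$) be such that a lattice $\Gamma_{2\pi r_2}$ exists in $G_{5.17}^{p,-p,r}\times\mathbb{R}$. Then $(G_{5.17}^{p,-p,r}\times\mathbb{R})/\Gamma_{2\pi r_2}$ admits an invariant symplectic form which is half-flat only for $p\ge0$ and $r=1$, and it admits a not invariant symplectic form which is half-flat. (3) Each of $(G_{5.18}^{0}\times\mathbb{R})/\Gamma_{2\pi}$ and $(G_{3.5}^{0}\times\mathbb{R}^3)/\Gamma_{2\pi}$ admits not invariant symplectic forms which are half-flat.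
   Context: Groups. Each group $G$ is the connected and simply connected six-dimensional Lie group whose Lie algebra $\mathfrak{g}$ has basis $X_1,\dots,X_6$ and the following nonzero brackets (up to antisymmetry). Next to it we list the nonzero brackets of the ''modified'' Lie algebra $\tilde{\mathfrak g}$ on the same vector space. $X_*$ is the indicated basis vector; the other five basis vectors span an abelian ideal $\mathbb{R}^5$ in both $\mathfrak{g}$ and $\tilde{\mathfrak g}$. - $G_{6.10}^{a=0}$, $X_*=X_6$, $\bar t=2\pi$: $[X_2,X_6]=X_1$, $[X_3,X_6]=X_2$, $[X_4,X_6]=-X_5$, $[X_5,X_6]=X_4$. Modified: $[X_2,X_6]=X_1$, $[X_3,X_6]=X_2$. - $G_{5.14}^{0}\times\mathbb{R}$, $X_*=X_5$, $\bar t=2\pi$: $[X_2,X_5]=X_1$, $[X_3,X_5]=-X_4$, $[X_4,X_5]=X_3$. Modified: $[X_2,X_5]=X_1$. - $G_{5.17}^{p,-p,r}\times\mathbb{R}$ ($r\ne0$; Lie algebra $\mathfrak{g}_{5.17}^{p,-p,r}\oplus\mathbb{R}$), $X_*=X_5$, $\bar t=2\pi r_2$: $[X_1,X_5]=pX_1-X_2$, $[X_2,X_5]=X_1+pX_2$, $[X_3,X_5]=-pX_3-rX_4$, $[X_4,X_5]=rX_3-pX_4$. Modified: $[X_1,X_5]=pX_1$, $[X_2,X_5]=pX_2$, $[X_3,X_5]=-pX_3$, $[X_4,X_5]=-pX_4$ (abelian if $p=0$). - $G_{5.18}^{0}\times\mathbb{R}$, $X_*=X_5$, $\bar t=2\pi$: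 $[X_1,X_5]=-X_2$, $[X_2,X_5]=X_1$, $[X_3,X_5]=X_1-X_4$, $[X_4,X_5]=X_2+X_3$. Modified: $[X_3,X_5]=X_1$, $[X_4,X_5]=X_2$. - $G_{3.5}^{0}\times\mathbb{R}^3$, $X_*=X_3$, $\bar t=2\pi$: $[X_1,X_3]=-X_2$, $[X_2,X_3]=X_1$. Modified: abelian. Lattices and modified groups. Let $B,\tilde B:\mathbb{R}^5\to\mathbb{R}^5$ be $X\mapsto[X,X_*]$ computed in $\mathfrak g$, respectively $\tilde{\mathfrak g}$, and $\varphi(t)=\exp(tB)$, $\tilde\varphi(t)=\exp(t\tilde B)$. Then $G=\mathbb{R}\ltimes_\varphi\mathbb{R}^5$ and $\tilde G=\mathbb{R}\ltimes_{\tilde\varphi}\mathbb{R}^5$, with products $(t,x)(t',x')=(t+t',x+\varphi(t)x')$, respectively with $\tilde\varphi$. For the indicated $\bar t$ one has $\varphi(\bar t)=\tilde\varphi(\bar t)$. $\Gamma_{\bar t}$ denotes a lattice $\bar t\,\mathbb{Z}\ltimes\Lambda$, where $\Lambda\subset\mathbb{R}^5$ is a lattice with $\varphi(\bar t)\Lambda=\Lambda$. It is a lattice in both $G$ and $\tilde G$, its left translations on $\mathbb{R}\times\mathbb{R}^5$ are the same for both group structures, and so the quotient by left translations, denoted $G/\Gamma_{\bar t}$, is the same manifold as $\tilde G/\Gamma_{\bar t}$. Forms. An invariant form on $G/\Gamma_{\bar t}$ is one induced by a left-invariant form on $G$. A not invariant symplectic form on $G/\Gamma_{\bar t}$ is here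 a symplectic form induced by a left-invariant symplectic form on $\tilde G$ and which is not induced by a left-invariant form on $G$. Half-flatness. An $SU(3)$-structure on a six-manifold defines a non-degenerate 2-form $\omega$, an almost complex structure $J$ and a complex volume form $\Psi$. It is half-flat if $\omega\wedge\omega$ and $\mathrm{Re}\,\Psi$ are closed; if in addition $\omega$ is closed it is called symplectic half-flat. A symplectic form $\omega$ induced by a left-invariant form on $H$ (where $H=G$ for invariant forms and $H=\tilde G$ for not invariant ones) is called half-flat if there is an $SU(3)$-structure induced by a left-invariant one on $H$ which is half-flat and whose 2-form is $\omega$.
   Formalization: In (2), an invariant symplectic form is claimed only if p=0 or |r|=1 (otherwise none exists); a half-flat one is shown for p≥0, r=1, and ''only for p≥0 and r=1'' is read up to isomorphism of the Lie algebra, as p<0 or r=-1 can also give half-flat forms. *)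

(* Defs.v *)
From HB Require Import structures.
From mathcomp Require Import all_boot all_order all_algebra all_fingroup.
From mathcomp Require Import complex.
From mathcomp Require Import all_classical all_reals all_analysis.

Set Implicit Arguments.
Unset Strict Implicit.
Unset Printing Implicit Defensive.

Import Order.TTheory GRing.Theory Num.Theory.
Import numFieldNormedType.Exports.

Local Open Scope classical_set_scope.
Local Open Scope ring_scope.
Local Open Scope complex_scope.

(** * Differential forms on R^6

    [pt R] is R x R^5, written as a block column (t, x); its tangent spaces are
    identified with itself.  A tensor field eating k vectors and taking values
    in T is a [field k T]; it is a k-form when [is_form] holds.  Smoothness is
    not recorded: below every field is left-invariant under a Lie group
    structure on R x R^5, hence smooth. *)

Notation pt R := 'cV[R]_(1 + 5).

Section Forms.
Variable R : realType.

Definition field k (T : Type) := pt R -> ('I_k -> pt R) -> T.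

Definition upd k (v : 'I_k -> pt R) (i : 'I_k) (x : pt R) : 'I_k -> pt R :=
  fun j => if j == i then x else v j.

Definition is_form k (al : field k R) : Prop := forall p v,
  (forall i a x y,
     al p (upd v i (a *: x + y)) = a * al p (upd v i x) + al p (upd v i y)) /\
  (forall i j, i != j -> v i = v j -> al p v = 0).

(* Exterior derivative on R^6: the v_i extend to constant, hence commuting,
   vector fields, so only the directional-derivative terms survive. *)
Definition dext k (al : field k R) : field k.+1 R := fun p v =>
  \sum_(i < k.+1)
    (-1) ^+ i * 'D_(v i) (fun q => al q (fun j => v (lift i j))) p.

Definition closed_form k (al : field k R) : Prop := forall p v, dext al p v = 0.

Definition wedge k l (al : field k R) (be : field l R) : field (k + l) R :=
  fun p v => (k`! * l`!)%:R^-1 *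
    \sum_(s : 'S_(k + l)) (-1) ^+ s * al p (fun i => v (s (lshift l i)))
                                    * be p (fun j => v (s (rshift k j))).

Definition vpair (u v : pt R) : 'I_2 -> pt R :=
  fun i => if i == ord0 then u else v.

Definition nondegenerate (w : field 2 R) : Prop :=
  forall p u, (forall v, w p (vpair u v) = 0) -> u = 0.

Definition symplectic (w : field 2 R) : Prop :=
  [/\ is_form w, closed_form w & nondegenerate w].

(* Pullback by f, whose differential at p is v |-> 'D_v f p. *)
Definition pullback k T (f : pt R -> pt R) (al : field k T) : field k T :=
  fun p v => al (f p) (fun i => 'D_(v i) f p).

(** * SU(3)-structures

    A triple (w, J, Psi) of tensor fields which at each point are given, in a
    suitable coframe (e^1, ..., e^6) with theta^a = e^(2a-1) + i e^(2a), by
      w = e^12 + e^34 + e^56,  theta^a o J = i theta^a,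
      Psi = theta^1 /\ theta^2 /\ theta^3.
    The rows of X are e^1, e^3, e^5 and those of Y are e^2, e^4, e^6. *)

Definition coframe (X Y : 'M[R]_(3, 6)) (a : 'I_3) (v : pt R) : R[i] :=
  ((X *m v) a ord0 +i* (Y *m v) a ord0)%C.

Definition is_su3 (w : field 2 R) (J : pt R -> pt R -> pt R)
    (Psi : field 3 R[i]) : Prop :=
  forall p, exists X Y : 'M[R]_(3, 6),
    [/\ (col_mx X Y : 'M[R]_6) \in unitmx,
        forall u v, w p (vpair u v) =
          \sum_(a < 3) ((X *m u) a ord0 * (Y *m v) a ord0
                        - (Y *m u) a ord0 * (X *m v) a ord0),
        forall a v, coframe X Y a (J p v) = (0 +i* 1)%C * coframe X Y a v
      & forall v, Psi p v = \det (\matrix_(a < 3, b < 3) coframe X Y a (v b))].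

Definition Re_form k (Psi : field k R[i]) : field k R :=
  fun p v => complex.Re (Psi p v).

(** * The groups R x| R^5 and their quotients *)

Definition expm (A : 'M[R]_5) : 'M[R]_5 :=
  limn (series (fun n => (n`!%:R)^-1 *: A ^+ n)).

Definition mkpt (t : R) (x : 'cV[R]_5) : pt R := col_mx t%:M x.
Definition tm (p : pt R) : R := usubmx p ord0 ord0.
Definition sp (p : pt R) : 'cV[R]_5 := dsubmx p.

(* The group R x|_phi R^5 with phi t = exp (t B), through its left
   translations. *)
Definition ltrans (B : 'M[R]_5) (g p : pt R) : pt R :=
  mkpt (tm g + tm p) (sp g + expm (tm g *: B) *m sp p).

Definition left_inv (B : 'M[R]_5) k T (al : field k T) : Prop :=
  forall g, pullback (ltrans B g) al = al.

Definition left_inv_endo (B : 'M[R]_5) (J : pt R -> pt R -> pt R) : Prop :=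
  forall g p v, J (ltrans B g p) ('D_v (ltrans B g) p)
                = 'D_(J p v) (ltrans B g) p.

Definition lattice (L : set 'cV[R]_5) : Prop :=
  exists2 P : 'M[R]_5, P \in unitmx &
    L = [set P *m map_mx intr z | z in [set: 'cV[int]_5]].

(* The condition on Lambda under which tb Z x| Lambda is a lattice. *)
Definition lattice_for (B : 'M[R]_5) (tb : R) (L : set 'cV[R]_5) : Prop :=
  lattice L /\ [set expm (tb *: B) *m x | x in L] = L.

Definition Gam (tb : R) (L : set 'cV[R]_5) : set (pt R) :=
  [set mkpt (n%:~R * tb) x | n in [set: int] & x in L].

(* Tensor fields on G / Gamma are the Gamma-invariant ones on its covering G. *)
Definition on_quotient (B : 'M[R]_5) (tb : R) (L : set 'cV[R]_5) k T
    (al : field k T) : Prop :=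
  forall g, Gam tb L g -> pullback (ltrans B g) al = al.

(* Below B defines G, Bt defines the modified group. *)
Definition invariant_symplectic (B : 'M[R]_5) (tb : R) (L : set 'cV[R]_5)
    (w : field 2 R) : Prop :=
  [/\ symplectic w, on_quotient B tb L w & left_inv B w].

Definition not_invariant_symplectic (B Bt : 'M[R]_5) (tb : R)
    (L : set 'cV[R]_5) (w : field 2 R) : Prop :=
  [/\ symplectic w, on_quotient B tb L w, left_inv Bt w & ~ left_inv B w].

Definition half_flat (B : 'M[R]_5) (w : field 2 R) : Prop :=
  exists (J : pt R -> pt R -> pt R) (Psi : field 3 R[i]),
    [/\ is_su3 w J Psi,
        [/\ left_inv B w, left_inv_endo B J & left_inv B Psi],
        closed_form (wedge w w)
      & closed_form (Re_form Psi)].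

(** * The Lie algebras

    [E i j] is the endomorphism of R^5 sending X_i to X_j and killing the other
    basis vectors, where the five basis vectors other than X_* are numbered
    from 1 in increasing order.  A bracket [X_i, X_*] = c X_j thus contributes
    c *: E i j to B : X |-> [X, X_*]. (Only basis vectors preceding X_* occur,
    and these keep their labels.) *)

Definition E (i j : nat) : 'M[R]_5 :=
  \matrix_(k, l) ((k.+1 == j) && (l.+1 == i))%:R.

Definition B610 : 'M[R]_5 := E 2 1 + E 3 2 - E 4 5 + E 5 4.
Definition Bt610 : 'M[R]_5 := E 2 1 + E 3 2.

Definition B514 : 'M[R]_5 := E 2 1 - E 3 4 + E 4 3.
Definition Bt514 : 'M[R]_5 := E 2 1.

Definition B517 (p r : R) : 'M[R]_5 :=
  (p *: E 1 1 - E 1 2) + (E 2 1 + p *: E 2 2)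
  + (- p *: E 3 3 - r *: E 3 4) + (r *: E 4 3 - p *: E 4 4).
Definition Bt517 (p : R) : 'M[R]_5 :=
  p *: E 1 1 + p *: E 2 2 - p *: E 3 3 - p *: E 4 4.

Definition B518 : 'M[R]_5 :=
  - E 1 2 + E 2 1 + (E 3 1 - E 3 4) + (E 4 2 + E 4 3).
Definition Bt518 : 'M[R]_5 := E 3 1 + E 4 2.

Definition B35 : 'M[R]_5 := - E 1 2 + E 2 1.
Definition Bt35 : 'M[R]_5 := 0.

(* The Lie algebra R X_* + R^5, in which (s, x) stands for s X_* + x. *)
Definition bracket (B : 'M[R]_5) (u v : pt R) : pt R :=
  mkpt 0 (tm v *: (B *m sp u) - tm u *: (B *m sp v)).

Definition lie_isomorphic (B B' : 'M[R]_5) : Prop :=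
  exists2 P : 'M[R]_(1 + 5), P \in unitmx &
    forall u v, P *m bracket B u v = bracket B' (P *m u) (P *m v).

End Forms.

(* Main.v *)
Require Import Defs.
From mathcomp Require Import all_boot all_order all_algebra all_fingroup.
From mathcomp Require Import complex.
From mathcomp Require Import all_classical all_reals all_analysis.
From mathcomp Require Import spectral.
From mathcomp Require Import ring lra.

Set Implicit Arguments.
Unset Strict Implicit.
Unset Printing Implicit Defensive.

Import Order.TTheory GRing.Theory Num.Theory.
Import numFieldNormedType.Exports.

Local Open Scope classical_set_scope.
Local Open Scope ring_scope.

(** The bracket of X_* with R^5 is one endomorphism B of R^5.  A left-invariant
    form on R x| R^5 is its value at the identity transported by exp (- t B), so
    it is closed if and only if its restriction to R^5 is annihilated by the
    derivation B.

    Let (omega, J, Psi) be symplectic half-flat.  After a rotation in SU(3), dt is a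
    multiple of the real part of theta^1.  On R^5 one then has
    omega = a/\c + b/\d and Re Psi = - h/\(a/\d + c/\b) for a basis
    (a, b, h, c, d) of covectors, and the stabiliser of this pair is exactly
    0 (+) sl(2, C), acting on the complex coordinates (z, w) = (a - ib, c + id).
    So a symplectic half-flat structure exists if and only if B is conjugate to
    an element of 0 (+) sl(2, C).  This makes the existence part a matter of
    choosing bases; for the non-existence part, such a B commutes with a complex
    structure K on its image and satisfies B^2 = u + vK there, which fails for
    G_6.10, G_5.14 and their modifications, and forces r^2 = 1 for G_5.17. *)

(** With z = a - ib and w = c + id, omega restricts to R^5 as the real part of dz/\dw, and Re Psi as
    -h times its imaginary part. Both conditions therefore say that B preserves one complex area
    form, whence sl(2, C). By Cayley-Hamilton a traceless complex 2x2 matrix squares to minus its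
    determinant: this is the scalar u + vK. It is the same on the whole image of B, so any two
    invariant planes of B can be played off against each other.

    A form invariant for the modified group descends to the quotient because B = Bt + S, where S
    commutes with Bt and is a sum of infinitesimal plane rotations whose exponentials are trivial at
    all integer multiples of the period. It fails to be invariant for G as soon as B itself does not
    annihilate it; each coframe below is chosen with a parameter, or a pairing of axes, that decides
    this.

    In G_5.17 the condition r^2 = 1 does not fix signs: reflecting one axis changes r into -r and
    exchanging the two planes changes p into -p. So [p >= 0] and [r = 1] is a normal form up to
    isomorphism. *)

(** * Small sums and explicit 5x5 matrices *)

Lemma sum2 (V : zmodType) (F : 'I_2 -> V) :
  \sum_(i < 2) F i = F (inord 0) + F (inord 1).
Proof.
rewrite !big_ord_recl big_ord0 addr0.
by congr (F _ + F _); apply: val_inj; rewrite /= inordK.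
Qed.

Lemma sum3 (V : zmodType) (F : 'I_3 -> V) :
  \sum_(i < 3) F i = F (inord 0) + F (inord 1) + F (inord 2).
Proof.
rewrite !big_ord_recl big_ord0 addr0 addrA.
by congr (F _ + F _ + F _); apply: val_inj; rewrite /= inordK.
Qed.

Lemma sum4 (V : zmodType) (F : 'I_4 -> V) : \sum_(i < 4) F i =
  F (inord 0) + F (inord 1) + F (inord 2) + F (inord 3).
Proof.
rewrite !big_ord_recl big_ord0 addr0 !addrA.
by congr (F _ + F _ + F _ + F _); apply: val_inj; rewrite /= inordK.
Qed.

Lemma sum5 (V : zmodType) (F : 'I_5 -> V) : \sum_(i < 5) F i =
  F (inord 0) + F (inord 1) + F (inord 2) + F (inord 3) + F (inord 4).
Proof.
rewrite !big_ord_recl big_ord0 addr0 !addrA.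
by congr (F _ + F _ + F _ + F _ + F _); apply: val_inj; rewrite /= inordK.
Qed.

Lemma lift_inord n (i : 'I_n.+1) (j : 'I_n) : lift i j = inord (bump i j).
Proof. by apply: val_inj; rewrite /= inordK//; exact: ltn_ord (lift i j). Qed.

(** Matrices as lists of rows: products and entries compute, and only scalar identities are left to
    [ring]. *)
Definition mx5 (R : realType) (r : seq (seq R)) : 'M[R]_5 :=
  \matrix_(i, j) nth 0 (nth [::] r i) j.

Ltac entries5 := let i := fresh "i" in let j := fresh "j" in
  apply/matrixP => i j; rewrite !(mxE, sum5) ?inordK //;
  case: i => [[|[|[|[|[|//]]]]] ?]; case: j => [[|[|[|[|[|//]]]]] ?];
  rewrite /=; ring.

Lemma mulmx5 (R : realType) (r s : seq (seq R)) : mx5 r *m mx5 s =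
  mx5 [seq [seq let x := nth [::] r i in
    x`_0 * (nth [::] s 0)`_j + x`_1 * (nth [::] s 1)`_j +
    x`_2 * (nth [::] s 2)`_j + x`_3 * (nth [::] s 3)`_j +
    x`_4 * (nth [::] s 4)`_j | j <- iota 0 5] | i <- iota 0 5].
Proof.
apply/matrixP => i j; rewrite !mxE sum5 /mx5 !mxE !inordK //.
by rewrite !(nth_map 0%N) ?size_iota // !nth_iota.
Qed.

(** * The matrix exponential *)

Section Expm.
Variable R : realType.
Implicit Types (A B S : 'M[R]_5) (t s : R).

Lemma cvgn_sum (V : normedModType R) (I : Type) (r : seq I) (f : I -> nat -> V)
    (a : I -> V) : (forall i, f i @ \oo --> a i) ->
  (fun n => \sum_(i <- r) f i n) @ \oo --> \sum_(i <- r) a i.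
Proof.
move=> fa; elim: r => [|i r IH].
  by under eq_fun do rewrite big_nil; rewrite big_nil; exact: cvg_cst.
by under eq_fun do rewrite big_cons; rewrite big_cons; exact: cvgD.
Qed.

(** The constant is the sum of all [|A i j|]; it dominates every row sum, so the bound passes from
    one power to the next. *)
Lemma exprmx_entry_le A : exists2 c : R, 0 <= c &
  forall n i j, `|(A ^+ n) i j| <= c ^+ n.
Proof.
exists (\sum_i \sum_j `|A i j|).
  by apply: sumr_ge0 => i _; exact: sumr_ge0.
set c := (X in forall n i j, _ <= X ^+ n).
have c0 : 0 <= c by apply: sumr_ge0 => i _; exact: sumr_ge0.
elim=> [|n IH] i j.
  by rewrite !expr0 mxE; case: (i == j); rewrite ?normr1 ?normr0.
rewrite !exprS -mulmxE mxE (le_trans (ler_norm_sum _ _ _))//.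
rewrite (@le_trans _ _ (\sum_k `|A i k| * c ^+ n))//.
  by apply: ler_sum => k _; rewrite normrM ler_wpM2l.
rewrite -mulr_suml ler_wpM2r ?exprn_ge0//.
rewrite /c [leRHS](bigD1 i)//= lerDl.
by apply: sumr_ge0 => k _; exact: sumr_ge0.
Qed.

Definition expm_coeff A i j : R^nat := fun n => n`!%:R^-1 * (A ^+ n) i j.

Lemma pseries_diffs_expm_coeff A i j :
  pseries_diffs (expm_coeff A i j) = (fun n => n`!%:R^-1 * (A ^+ n.+1) i j).
Proof.
apply/funext => n; rewrite /pseries_diffs /expm_coeff factS natrM invfM.
by rewrite mulrA mulrA mulfV ?mul1r// pnatr_eq0.
Qed.

(** Domination by [c ^+ m] times the exponential series of [c * |t|]. The shifts 0, 1 and 2 give the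
    series and its first two formal derivatives, which termwise differentiation asks for. *)
Lemma is_cvg_pseries_shift_exprmx A m i j t :
  cvgn (pseries (fun n => n`!%:R^-1 * (A ^+ (n + m)) i j) t).
Proof.
have [c c0 Hc] := exprmx_entry_le A.
apply: normed_cvg; apply: (@series_le_cvg _ _
  (fun n => c ^+ m * exp_coeff (c * `|t|) n)) => [n|n|n|].
- by rewrite /= normr_ge0.
- by rewrite /exp_coeff /= mulr_ge0 ?exprn_ge0// mulr_ge0 ?exprn_ge0 ?mulr_ge0.
- rewrite /exp_coeff /= !normrM ger0_norm ?invr_ge0// normrX exprMn.
  rewrite [leRHS](_ : _ = n`!%:R^-1 * c ^+ (n + m) * `|t| ^+ n).
    by rewrite ler_wpM2r ?exprn_ge0// ler_wpM2l// invr_ge0.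
  by rewrite exprD; ring.
- exact/is_cvg_seriesZ/is_cvg_series_exp_coeff.
Qed.

(** The limit in [expm] is taken in the space of matrices. Expanding on the [delta_mx] basis turns
    it into scalar power series, which can be differentiated termwise. *)
Lemma expm_entry A t i j :
  expm (t *: A) i j = limn (pseries (expm_coeff A i j) t).
Proof.
have Hc k l : cvgn (pseries (expm_coeff A k l) t).
  have := @is_cvg_pseries_shift_exprmx A 0 k l t.
  by under eq_fun do rewrite addn0.
suff H : series (fun n => n`!%:R^-1 *: (t *: A) ^+ n) @ \oo -->
    (\matrix_(k, l) limn (pseries (expm_coeff A k l) t) : 'M[R]_5).
  by rewrite /expm (cvg_lim _ H)// mxE.
have -> : series (fun n => n`!%:R^-1 *: (t *: A) ^+ n) =
    (fun n => \sum_k \sum_l pseries (expm_coeff A k l) t n *: delta_mx k l).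
  apply/funext => n; rewrite [LHS]matrix_sum_delta; apply: eq_bigr => k _.
  apply: eq_bigr => l _; congr (_ *: _); rewrite /pseries /series /= summxE.
  by apply: eq_bigr => m _; rewrite exprZn !mxE /expm_coeff; ring.
rewrite [X in _ --> X]matrix_sum_delta.
apply: cvgn_sum => k; apply: cvgn_sum => l; rewrite mxE.
exact: cvgZr_tmp.
Qed.

Lemma expm0 : expm (0 : 'M[R]_5) = 1%:M.
Proof.
rewrite /expm; apply: lim_near_cst => //.
near=> n; rewrite /series /= -[n]prednK; last by near: n.
rewrite big_nat_recl//= expr0 fact0 invr1 scale1r big1 ?addr0// => i _.
by rewrite expr0n /= scaler0.
Unshelve. all: by end_near. Qed.

Lemma is_derive_expm_entry A t i j :
  is_derive t 1 (fun s => expm (s *: A) i j) ((A *m expm (t *: A)) i j).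
Proof.
have Hc m k l s := @is_cvg_pseries_shift_exprmx A m k l s.
have -> : (fun s => expm (s *: A) i j) =
    (fun s => limn (pseries (expm_coeff A i j) s)).
  by apply/funext => s; exact: expm_entry.
have -> : (A *m expm (t *: A)) i j =
    limn (pseries (pseries_diffs (expm_coeff A i j)) t).
  rewrite mxE; apply/esym/cvg_lim => //.
  rewrite [X in X @ _ --> _](_ : _ =
      (fun n => \sum_k (A i k * pseries (expm_coeff A k j) t n))).
    apply: cvgn_sum => k; rewrite expm_entry; apply: cvgMl_tmp.
    by have := Hc 0%N k j t; under eq_fun do rewrite addn0.
  apply/funext => n; rewrite /pseries /series /= pseries_diffs_expm_coeff.
  under [RHS]eq_bigr do rewrite mulr_sumr.
  rewrite exchange_big /=; apply: eq_bigr => m _.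
  rewrite exprS -mulmxE mxE mulr_sumr mulr_suml; apply: eq_bigr => k _.
  by rewrite /expm_coeff; ring.
apply: (@pseries_snd_diffs _ _ (`|t| + 1)).
- by have := Hc 0%N i j (`|t| + 1); under eq_fun do rewrite addn0.
- rewrite pseries_diffs_expm_coeff.
  by have := Hc 1%N i j (`|t| + 1); under eq_fun do rewrite addn1.
- rewrite pseries_diffs_expm_coeff.
  rewrite (_ : pseries_diffs _ = (fun n => n`!%:R^-1 * (A ^+ (n + 2)) i j)).
    exact: Hc.
  apply/funext => n; rewrite /pseries_diffs factS natrM invfM addn2.
  by rewrite mulrA mulrA mulfV ?mul1r// pnatr_eq0.
- by rewrite [ltRHS]ger0_norm ?addr_ge0// ltrDl.
Qed.

Lemma expm_comm A B t : A *m B = B *m A ->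
  expm (t *: A) *m B = B *m expm (t *: A).
Proof.
move=> AB; apply/matrixP => i j; rewrite !mxE.
have Hc k l : cvgn (pseries (expm_coeff A k l) t).
  have := @is_cvg_pseries_shift_exprmx A 0 k l t.
  by under eq_fun do rewrite addn0.
have H1 : (fun n => \sum_k (pseries (expm_coeff A i k) t n * B k j)) @ \oo -->
    \sum_k expm (t *: A) i k * B k j.
  by apply: cvgn_sum => k; rewrite expm_entry; exact: cvgMr_tmp.
have H2 : (fun n => \sum_k (B i k * pseries (expm_coeff A k j) t n)) @ \oo -->
    \sum_k B i k * expm (t *: A) k j.
  by apply: cvgn_sum => k; rewrite expm_entry; exact: cvgMl_tmp.
rewrite -(cvg_lim (@Rhausdorff R) H1) -(cvg_lim (@Rhausdorff R) H2).
congr (limn _); apply/funext => n; rewrite /pseries /series /=.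
under eq_bigr do rewrite mulr_suml.
under [RHS]eq_bigr do rewrite mulr_sumr.
rewrite exchange_big [RHS]exchange_big /=; apply: eq_bigr => m _.
have -> : \sum_k expm_coeff A i k m * t ^+ m * B k j =
    m`!%:R^-1 * t ^+ m * (A ^+ m *m B) i j.
  rewrite mxE mulr_sumr; apply: eq_bigr => k _; rewrite /expm_coeff; ring.
have -> : \sum_k B i k * (expm_coeff A k j m * t ^+ m) =
    m`!%:R^-1 * t ^+ m * (B *m A ^+ m) i j.
  rewrite mxE mulr_sumr; apply: eq_bigr => k _; rewrite /expm_coeff; ring.
congr (_ * fun_of_matrix _ i j); elim: m => [|m IH].
  by rewrite !expr0 mulmx1 mul1mx.
by rewrite exprSr -mulmxE -mulmxA AB mulmxA IH -mulmxA.
Qed.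

(* The derivative of [F (- t) *m G t] vanishes when [F' = A F] and [G' = A G],
   so a linear system has only one solution with given initial value. *)
Lemma expmNK A (G : R -> 'M[R]_5) :
  (forall t i j, is_derive t 1 (fun s => G s i j) ((A *m G t) i j)) ->
  forall t, expm (- t *: A) *m G t = G 0.
Proof.
move=> dG t; apply/matrixP => i j.
pose f s := (expm (- s *: A) *m G s) i j.
suff /(_ t 0) : forall x y, f x = f y.
  by rewrite /f oppr0 scale0r expm0 mul1mx.
move=> x y; apply: is_derive_0_is_cst => {x y} x.
have dE i' k : is_derive x 1 (fun s => expm (- s *: A) i' k)
    (- (A *m expm (- x *: A)) i' k).
  have H1 := is_derive_expm_entry A (- x) i' k.
  have H2 : is_derive x 1 -%R (- 1 : R) := is_deriveNid _ _.
  by have := is_derive1_comp H1 H2; rewrite mulrN1.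
have -> : f =
    \sum_(k < 5) ((fun s => expm (- s *: A) i k) * (fun s => G s k j)).
  apply/funext => s; rewrite /f mxE fct_sumE; apply: eq_bigr => k _ //.
apply: is_derive_eq; rewrite big_split /=.
have -> : \sum_(k < 5) expm (- x *: A) i k *: (A *m G x) k j =
    (expm (- x *: A) *m A *m G x) i j.
  by rewrite -mulmxA mxE.
have -> : \sum_(k < 5) G x k j *: - (A *m expm (- x *: A)) i k =
    - (A *m expm (- x *: A) *m G x) i j.
  rewrite mxE -sumrN; apply: eq_bigr => k _.
  by rewrite /GRing.scale /= mulrN mulrC.
by rewrite (@expm_comm A A)// subrr.
Qed.

Lemma expmKN A t : expm (- t *: A) *m expm (t *: A) = 1%:M.
Proof.
have /(_ t) := @expmNK A (fun s => expm (s *: A)) (is_derive_expm_entry A).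
by rewrite scale0r expm0.
Qed.

Lemma expmNKr A t : expm (t *: A) *m expm (- t *: A) = 1%:M.
Proof. by have := expmKN A (- t); rewrite opprK. Qed.

(** The tool for the addition, commutation and rotation formulas below: each one is checked through
    a differential equation and an initial value, without multiplying series. *)
Lemma expm_uniq A (G : R -> 'M[R]_5) : G 0 = 1%:M ->
  (forall t i j, is_derive t 1 (fun s => G s i j) ((A *m G t) i j)) ->
  forall t, G t = expm (t *: A).
Proof.
move=> G0 /expmNK dG t.
by rewrite -[RHS]mulmx1 -G0 -(dG t) mulmxA expmNKr mul1mx.
Qed.

Lemma expm_addl A s t : expm ((s + t) *: A) = expm (s *: A) *m expm (t *: A).
Proof.
rewrite -[LHS]mul1mx -(expmNKr A s) -mulmxA; congr (_ *m _).
move: t; apply: expm_uniq => [|t i j]; first by rewrite addr0 expmKN.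
have -> : (fun t => (expm (- s *: A) *m expm ((s + t) *: A)) i j) =
    \sum_(k < 5) (expm (- s *: A) i k *: (fun t => expm ((s + t) *: A) k j)).
  by apply/funext => u; rewrite mxE fct_sumE.
have dE k : is_derive t 1 (fun u => expm ((s + u) *: A) k j)
    ((A *m expm ((s + t) *: A)) k j).
  have H1 := is_derive_expm_entry A (s + t) k j.
  have H2 : is_derive t 1 (fun u => s + u : R) 1.
    have := is_deriveD (is_derive_cst s t 1) (is_derive_id t (1 : R)).
    by rewrite add0r.
  by have := is_derive1_comp H1 H2; rewrite mulr1.
apply: is_derive_eq.
by rewrite mulmxA -[A *m expm (- s *: A)](@expm_comm A A)// -mulmxA [RHS]mxE.
Qed.

Lemma expm_add_comm A B t : A *m B = B *m A ->
  expm (t *: (A + B)) = expm (t *: A) *m expm (t *: B).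
Proof.
move=> AB; apply/esym; move: t; apply: expm_uniq => [|t i j].
  by rewrite !scale0r expm0 mul1mx.
have -> : (fun t => (expm (t *: A) *m expm (t *: B)) i j) =
    \sum_(k < 5) ((fun t => expm (t *: A) i k) * (fun t => expm (t *: B) k j)).
  by apply/funext => u; rewrite mxE fct_sumE.
have dA := is_derive_expm_entry A t.
have dB := is_derive_expm_entry B t.
apply: is_derive_eq; rewrite big_split /= addrC.
have -> : \sum_(k < 5) expm (t *: A) i k *: (B *m expm (t *: B)) k j =
    (B *m expm (t *: A) *m expm (t *: B)) i j.
  by rewrite -[B *m expm (t *: A)]expm_comm// -mulmxA [RHS]mxE.
have -> : \sum_(k < 5) expm (t *: B) k j *: (A *m expm (t *: A)) i k =
    (A *m expm (t *: A) *m expm (t *: B)) i j.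
  by rewrite [RHS]mxE; apply: eq_bigr => k _; rewrite /GRing.scale /= mulrC.
by rewrite mulmxDl !mulmxA [RHS]mxE.
Qed.

(** Rodrigues' formula: since S^3 = -S, the span of 1, S, S^2 is stable under S, and the right-hand
    side solves the defining equation. *)
Lemma expm_rotation S t : S *m S *m S = - S ->
  expm (t *: S) = 1%:M + sin t *: S + (1 - cos t) *: (S *m S).
Proof.
move=> S3; apply/esym; move: t; apply: expm_uniq => [|t i j].
  by rewrite sin0 cos0 subrr !scale0r !addr0.
have -> : (fun t => (1%:M + sin t *: S + (1 - cos t) *: (S *m S)) i j) =
    cst ((1%:M + S *m S) i j) + (S i j *: sin - (S *m S) i j *: cos).
  apply/funext => u; rewrite !fctE; set S2 := S *m S.
  by rewrite !mxE /GRing.scale /=; ring.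
have dsin := is_derive_sin t; have dcos := is_derive_cos t.
apply: (is_derive_eq (is_deriveD (is_derive_cst _ t 1)
  (is_deriveB (@is_deriveZ _ _ _ _ (S i j) _ _ _ dsin)
              (@is_deriveZ _ _ _ _ ((S *m S) i j) _ _ _ dcos)))).
rewrite !mulmxDr -!scalemxAr mulmx1 mulmxA S3; set S2 := S *m S.
by rewrite !mxE /GRing.scale /=; ring.
Qed.

Lemma expm_rotation_2pi S (n : int) : S *m S *m S = - S ->
  expm ((2 * pi * n%:~R) *: S) = 1%:M.
Proof.
move=> S3; rewrite expm_rotation//.
suff [-> ->] : sin (2 * pi * n%:~R) = 0 :> R /\ cos (2 * pi * n%:~R) = 1 :> R.
  by rewrite subrr !scale0r !addr0.
have Hnat (k : nat) :
    sin (2 * pi * k%:R) = 0 :> R /\ cos (2 * pi * k%:R) = 1 :> R.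
  have -> : 2 * pi * k%:R = 0 + pi *+ 2 *+ k :> R.
    by rewrite add0r -[pi *+ 2]mulr_natl -[RHS]mulr_natr.
  by rewrite !periodicn ?sin0 ?cos0//; [exact: cosD2pi | exact: sinD2pi].
case: n => k; first exact: Hnat.
have [s0 c1] := Hnat k.+1.
by rewrite NegzE rmorphN /= mulrN sinN cosN s0 c1 oppr0.
Qed.

End Expm.

(** * Left-invariant fields *)

Section LeftInvariantFields.
Variable R : realType.
Implicit Types (B Q : 'M[R]_5) (u v p g : pt R) (t : R).

(** The differential of the left translation by any g with [tm g = t]; translations are affine, so
    it does not depend on the point. *)
Definition dltrans B t : 'M[R]_(1 + 5) := block_mx 1%:M 0 0 (expm (t *: B)).

(** The map X |-> [X, X_*] on the whole Lie algebra, hence 0 on X_* itself. *)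
Definition ad_star B : 'M[R]_(1 + 5) := block_mx 0 0 0 B.

Lemma tmE p : tm p = p (lshift 5 ord0) ord0.
Proof. by rewrite /tm mxE. Qed.

Lemma tm_is_linear (a : R) u v : tm (a *: u + v) = a * tm u + tm v.
Proof. by rewrite !tmE !mxE. Qed.

Lemma mkptE p : mkpt (tm p) (sp p) = p.
Proof. by rewrite /mkpt /tm /sp -mx11_scalar vsubmxK. Qed.

Lemma tm_mkpt t (x : 'cV[R]_5) : tm (mkpt t x) = t.
Proof. by rewrite /tm /mkpt col_mxKu mxE mulr1n. Qed.

Lemma sp_mkpt t (x : 'cV[R]_5) : sp (mkpt t x) = x.
Proof. by rewrite /sp /mkpt col_mxKd. Qed.

Lemma tm0 : tm (0 : pt R) = 0.
Proof. by rewrite tmE mxE. Qed.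

Lemma sp0 : sp (0 : pt R) = 0.
Proof. by rewrite /sp linear0. Qed.

Lemma mul_block_mkpt (a : R) (M : 'M[R]_5) u :
  (block_mx a%:M 0 0 M : 'M[R]_(1 + 5)) *m u = mkpt (a * tm u) (M *m sp u).
Proof.
rewrite -[in LHS](mkptE u) /mkpt mul_block_col !mul0mx addr0 add0r.
by rewrite -scalar_mxM.
Qed.

Lemma dltransE B t u : dltrans B t *m u = mkpt (tm u) (expm (t *: B) *m sp u).
Proof. by rewrite /dltrans mul_block_mkpt mul1r. Qed.

Lemma ad_starE B u : ad_star B *m u = mkpt 0 (B *m sp u).
Proof.
by rewrite /ad_star -[X in block_mx X](raddf0 (@scalar_mx R 1))
  mul_block_mkpt mul0r.
Qed.

Lemma dltrans0 B : dltrans B 0 = 1%:M.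
Proof. by rewrite /dltrans scale0r expm0 -scalar_mx_block. Qed.

Lemma dltransD B s t : dltrans B (s + t) = dltrans B s *m dltrans B t.
Proof.
rewrite /dltrans mulmx_block !mulmx0 !mul0mx !addr0 add0r mul1mx.
by rewrite expm_addl.
Qed.

Lemma dltransNK B t u : dltrans B (- t) *m (dltrans B t *m u) = u.
Proof. by rewrite mulmxA -dltransD addNr dltrans0 mul1mx. Qed.

Lemma dltransKN B t u : dltrans B t *m (dltrans B (- t) *m u) = u.
Proof. by rewrite mulmxA -dltransD subrr dltrans0 mul1mx. Qed.

Lemma ltransE B g p : ltrans B g p = dltrans B (tm g) *m p + g.
Proof.
rewrite dltransE /ltrans -[X in _ = _ + X](mkptE g) /mkpt add_col_mx -raddfD.
by rewrite [tm g + _]addrC [sp g + _]addrC.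
Qed.

Lemma derive_ltrans B g v p : 'D_v (ltrans B g) p = dltrans B (tm g) *m v.
Proof.
apply: lim_near_cst => //; near=> h.
rewrite /= !ltransE mulmxDr.
rewrite [X in h^-1 *: X](_ : _ = h *: (dltrans B (tm g) *m v)).
  by rewrite scalerA mulVf ?scale1r//; near: h; exact: nbhs_dnbhs_neq.
by rewrite -scalemxAr opprD addrACA subrr addr0 addrK.
Unshelve. all: by end_near. Qed.

Lemma tm_ltrans B g p : tm (ltrans B g p) = tm g + tm p.
Proof. by rewrite tm_mkpt. Qed.

Lemma ltrans0 B g : ltrans B g 0 = g.
Proof. by rewrite ltransE mulmx0 add0r. Qed.

Lemma left_invP B k T (al : field R k T) : left_inv B al <->
  forall g p (v : 'I_k -> pt R),
    al (ltrans B g p) (fun i => dltrans B (tm g) *m v i) = al p v.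
Proof.
have E g p (v : 'I_k -> pt R) : pullback (ltrans B g) al p v =
    al (ltrans B g p) (fun i => dltrans B (tm g) *m v i).
  rewrite /pullback; congr (al _ _).
  by apply/funext => i; rewrite derive_ltrans.
split=> H g; first by move=> p v; rewrite -E H.
by apply/funext => p; apply/funext => v; rewrite E H.
Qed.

(** The left-invariant extension of a tensor [a] at the identity: vectors at p are translated back
    to the identity. *)
Definition linv B k T (a : ('I_k -> pt R) -> T) : field R k T :=
  fun p (v : 'I_k -> pt R) => a (fun i => dltrans B (- tm p) *m v i).

Lemma linv_left_inv B k T (a : ('I_k -> pt R) -> T) : left_inv B (linv B a).
Proof.
apply/left_invP => g p v; rewrite /linv tm_ltrans; congr (a _).
apply/funext => i.
have -> : - (tm g + tm p) = - tm p + - tm g by rewrite opprD addrC.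
by rewrite dltransD -mulmxA; congr (_ *m _); exact: dltransNK.
Qed.

Lemma left_inv_linv B k T (al : field R k T) : left_inv B al ->
  al = linv B (al 0).
Proof.
move=> /left_invP H; apply/funext => q; apply/funext => v.
rewrite /linv -(H q 0) ltrans0; congr (al _ _).
by apply/funext => i; rewrite (dltransKN B (tm q)).
Qed.

(** A translation by g sees B only through [expm (tm g *: B)]. This is how fields invariant for the
    modified group descend to the quotient by the lattice. *)
Lemma pullback_linv_eq B B' g k T (al : field R k T) : left_inv B' al ->
  expm (tm g *: B) = expm (tm g *: B') -> pullback (ltrans B g) al = al.
Proof.
move=> H E; have -> : ltrans B g = ltrans B' g; last exact: H.
by apply/funext => p; rewrite /ltrans E.
Qed.

Lemma derive_tm (f : R -> R) p u (df : R) : is_derive (tm p) 1 f df ->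
  is_derive p u (fun q => f (tm q)) (tm u * df).
Proof.
move=> Hf; have dif : differentiable f (tm p).
  by apply/derivable1_diffP; case: Hf.
have E :
    (fun h => h^-1 *: (((fun q => f (tm q)) \o shift p) (h *: u) - f (tm p))) =
    (fun h => h^-1 *: ((f \o shift (tm p)) (h *: tm u) - f (tm p))).
  by apply/funext => h; rewrite /= tm_is_linear.
split; first by rewrite /derivable E; exact: diff_derivable.
rewrite /derive E; transitivity ('D_(tm u) f (tm p)) => //.
rewrite deriveE// -[X in 'd f _ X]mulr1 [LHS]linearZ /= -deriveE//.
by rewrite derive_val.
Qed.

Lemma is_derive_dltrans B t i j :
  is_derive t 1 (fun s => dltrans B (- s) i j)
    (- (ad_star B *m dltrans B (- t)) i j).
Proof.
have dE k l : is_derive t 1 (fun s => expm (- s *: B) k l)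
    (- (B *m expm (- t *: B)) k l).
  have H1 := is_derive_expm_entry B (- t) k l.
  by have := is_derive1_comp H1 (is_deriveNid t (1 : R)); rewrite mulrN1.
rewrite /dltrans /ad_star mulmx_block !(mulmx0, mul0mx, addr0, add0r).
case: (split_ordP i) => k ->; case: (split_ordP j) => l ->.
- under eq_fun do rewrite block_mxEul.
  by rewrite block_mxEul [X in - X]mxE oppr0; exact: is_derive_cst.
- under eq_fun do rewrite block_mxEur mxE.
  by rewrite block_mxEur [X in - X]mxE oppr0; exact: is_derive_cst.
- under eq_fun do rewrite block_mxEdl mxE.
  by rewrite block_mxEdl [X in - X]mxE oppr0; exact: is_derive_cst.
- under eq_fun do rewrite block_mxEdr.
  by rewrite block_mxEdr.
Qed.

Lemma is_derive_dltrans_coord B m (X : 'M[R]_(m, 1 + 5)) v a t :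
  is_derive t 1 (fun s => (X *m (dltrans B (- s) *m v)) a ord0)
    (- (X *m (ad_star B *m (dltrans B (- t) *m v))) a ord0).
Proof.
have E (M : 'M[R]_(1 + 5)) : (X *m (M *m v)) a ord0 =
    \sum_(i < 1 + 5) \sum_(j < 1 + 5) X a i * v j ord0 * M i j.
  rewrite mxE; apply: eq_bigr => i _; rewrite mxE mulr_sumr.
  by apply: eq_bigr => j _; ring.
have -> : (fun s => (X *m (dltrans B (- s) *m v)) a ord0) =
  \sum_(i < 1 + 5) \sum_(j < 1 + 5)
    ((X a i * v j ord0) *: (fun s => dltrans B (- s) i j)).
  apply/funext => s; rewrite E fct_sumE; apply: eq_bigr => i _.
  by rewrite fct_sumE.
have dE := is_derive_dltrans B t.
apply: is_derive_eq; rewrite [ad_star B *m (_ *m v)]mulmxA E -sumrN.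
apply: eq_bigr => i _.
by rewrite -sumrN; apply: eq_bigr => j _; rewrite /GRing.scale /= mulrN.
Qed.

End LeftInvariantFields.

(** * Derivatives in t of transported 2-forms and of the real volume form *)

Section Dext.
Variable R : realType.
Implicit Types (B Q : 'M[R]_5) (X Y : 'M[R]_(3, 6)) (t : R).

Definition pfaff X Y (u v : pt R) : R :=
  \sum_(a < 3) ((X *m u) a ord0 * (Y *m v) a ord0
                - (Y *m u) a ord0 * (X *m v) a ord0).

Definition cvol X Y (v : 'I_3 -> pt R) : R[i] :=
  \det (\matrix_(a < 3, b < 3) coframe X Y a (v b)).

Lemma det3 (K : comRingType) (f : nat -> nat -> K) :
  \det (\matrix_(i < 3, j < 3) f i j) =
    f 0%N 0%N * (f 1%N 1%N * f 2%N 2%N - f 1%N 2%N * f 2%N 1%N)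
    - f 0%N 1%N * (f 1%N 0%N * f 2%N 2%N - f 1%N 2%N * f 2%N 0%N)
    + f 0%N 2%N * (f 1%N 0%N * f 2%N 1%N - f 1%N 1%N * f 2%N 0%N).
Proof.
rewrite (expand_det_row _ ord0) !big_ord_recl big_ord0 /cofactor.
rewrite !(expand_det_row _ ord0) !big_ord_recl !big_ord0 /cofactor.
rewrite !(expand_det_row _ ord0) !big_ord_recl !big_ord0 /cofactor !det_mx00.
by rewrite !mxE /= /bump /= !addn0 !add0n; ring.
Qed.

(* Re \det (x + i y), expanded along the first row. *)
Definition Re_det3 (x y : nat -> nat -> R) : R :=
  let d a b := x 1%N a * x 2%N b - y 1%N a * y 2%N b
    - (x 1%N b * x 2%N a - y 1%N b * y 2%N a) in
  let e a b := x 1%N a * y 2%N b + y 1%N a * x 2%N b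
    - (x 1%N b * y 2%N a + y 1%N b * x 2%N a) in
  x 0%N 0%N * d 1%N 2%N - y 0%N 0%N * e 1%N 2%N
  - (x 0%N 1%N * d 0%N 2%N - y 0%N 1%N * e 0%N 2%N)
  + (x 0%N 2%N * d 0%N 1%N - y 0%N 2%N * e 0%N 1%N).

Lemma Re_cvol X Y v : complex.Re (cvol X Y v) =
  Re_det3 (fun a b => (X *m v (inord b)) (inord a) ord0)
          (fun a b => (Y *m v (inord b)) (inord a) ord0).
Proof.
pose F a b := coframe X Y (inord a) (v (inord b)).
have -> : cvol X Y v = \det (\matrix_(a < 3, b < 3) F a b).
  rewrite /cvol; congr (\det _).
  by apply/matrixP => a b; rewrite !mxE /F !inord_val.
rewrite (det3 F) /F /coframe /Re_det3.
simpc; rewrite /=.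
ring.
Qed.

(** Leibniz rule, one column (that is, one vector argument) at a time. The minus signs are those of
    transport by exp (- t B). *)
Lemma is_derive_Re_det3 (f g : nat -> nat -> R -> R) (f' g' : nat -> nat -> R)
    t :
  (forall a b, is_derive t 1 (f a b) (- f' a b)) ->
  (forall a b, is_derive t 1 (g a b) (- g' a b)) ->
  is_derive t 1 (fun s => Re_det3 (fun a b => f a b s) (fun a b => g a b s))
    (- \sum_(i < 3) Re_det3
      (fun a b => if b == i then f' a b else f a b t)
      (fun a b => if b == i then g' a b else g a b t)).
Proof.
move=> df dg; rewrite sum3 /Re_det3 !inordK //=.
have dd a b := is_deriveB
  (is_deriveB (is_deriveM (df 1%N a) (df 2%N b))
              (is_deriveM (dg 1%N a) (dg 2%N b)))
  (is_deriveB (is_deriveM (df 1%N b) (df 2%N a))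
              (is_deriveM (dg 1%N b) (dg 2%N a))).
have de a b := is_deriveB
  (is_deriveD (is_deriveM (df 1%N a) (dg 2%N b))
              (is_deriveM (dg 1%N a) (df 2%N b)))
  (is_deriveD (is_deriveM (df 1%N b) (dg 2%N a))
              (is_deriveM (dg 1%N b) (df 2%N a))).
apply: (is_derive_eq (is_deriveD (is_deriveB
    (is_deriveB (is_deriveM (df 0%N 0%N) (dd 1%N 2%N))
                (is_deriveM (dg 0%N 0%N) (de 1%N 2%N)))
    (is_deriveB (is_deriveM (df 0%N 1%N) (dd 0%N 2%N))
                (is_deriveM (dg 0%N 1%N) (de 0%N 2%N))))
    (is_deriveB (is_deriveM (df 0%N 2%N) (dd 0%N 1%N))
                (is_deriveM (dg 0%N 2%N) (de 0%N 1%N))))).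
by rewrite !fctE /GRing.scale /=; ring.
Qed.

Lemma is_derive_Re_cvol B X Y (v : 'I_3 -> pt R) t :
  let w s := fun i => dltrans B (- s) *m v i in
  is_derive t 1 (fun s => complex.Re (cvol X Y (w s)))
    (- \sum_(i < 3) complex.Re (cvol X Y (upd (w t) i (ad_star B *m w t i)))).
Proof.
move=> w.
pose f (Z : 'M[R]_(3, 6)) a b s := (Z *m w s (inord b)) (inord a) ord0.
pose f' (Z : 'M[R]_(3, 6)) a b :=
  (Z *m (ad_star B *m w t (inord b))) (inord a) ord0.
have df Z a b : is_derive t 1 (f Z a b) (- f' Z a b).
  exact: is_derive_dltrans_coord.
under eq_fun do rewrite Re_cvol.
apply: (is_derive_eq (is_derive_Re_det3 (df X) (df Y))).
congr (- _); rewrite !sum3 !Re_cvol /Re_det3 /upd /=.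
by rewrite -!val_eqE /= !inordK.
Qed.

Lemma is_derive_pfaff B X Y u v t :
  let u' := dltrans B (- t) *m u in let v' := dltrans B (- t) *m v in
  is_derive t 1
    (fun s => pfaff X Y (dltrans B (- s) *m u) (dltrans B (- s) *m v))
    (- (pfaff X Y (ad_star B *m u') v' + pfaff X Y u' (ad_star B *m v'))).
Proof.
move=> u' v'; rewrite /pfaff.
have dX w a := is_derive_dltrans_coord B X w a t.
have dY w a := is_derive_dltrans_coord B Y w a t.
have -> : (fun s => \sum_(a < 3)
   ((X *m (dltrans B (- s) *m u)) a ord0 *
    (Y *m (dltrans B (- s) *m v)) a ord0 -
    (Y *m (dltrans B (- s) *m u)) a ord0 *
    (X *m (dltrans B (- s) *m v)) a ord0))
  = \sum_(a < 3) (
   (fun s => (X *m (dltrans B (- s) *m u)) a ord0) *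
   (fun s => (Y *m (dltrans B (- s) *m v)) a ord0) -
   (fun s => (Y *m (dltrans B (- s) *m u)) a ord0) *
   (fun s => (X *m (dltrans B (- s) *m v)) a ord0)).
  by apply/funext => s; rewrite fct_sumE.
apply: is_derive_eq; rewrite -big_split -sumrN /=; apply: eq_bigr => a _.
by rewrite /GRing.scale /= -/u' -/v'; ring.
Qed.

End Dext.

(** * Closedness of left-invariant forms and adapted coframes *)

Section ClosedForms.
Variable R : realType.
Implicit Types (B Q : 'M[R]_5) (X Y : 'M[R]_(3, 6)) (t : R).

Lemma vpairE (v : 'I_2 -> pt R) : v = vpair (v ord0) (v ord_max).
Proof.
apply/funext => i; rewrite /vpair; case: ifPn => [/eqP -> //|].
by case: i => [[|[|//]]] //= H _; congr (v _); apply: val_inj.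
Qed.

Definition pfaff_form X Y (v : 'I_2 -> pt R) : R :=
  pfaff X Y (v ord0) (v ord_max).

Definition Re_cvol_form X Y (v : 'I_3 -> pt R) : R := complex.Re (cvol X Y v).

Lemma tm_dltrans B t u : tm (dltrans B t *m u) = tm u.
Proof. by rewrite dltransE tm_mkpt. Qed.

(** This is d alpha = - dt /\ L alpha, where L is the action of the derivation B on forms: the
    coefficients of alpha depend on t alone, so the derivative along [v i] carries the factor
    [tm (v i)]. *)
Lemma dext_linv B k (a La : ('I_k -> pt R) -> R) p v :
  (forall v t, is_derive t 1 (fun s => a (fun i => dltrans B (- s) *m v i))
                             (- La (fun i => dltrans B (- t) *m v i))) ->
  dext (linv B a) p v = - \sum_(i < k.+1) (-1) ^+ i *
    (tm (v i) * La (fun j => dltrans B (- tm p) *m v (lift i j))).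
Proof.
move=> Ha; rewrite -sumrN; apply: eq_bigr => i _.
have H := derive_tm (v i) (Ha (fun j => v (lift i j)) (tm p)).
have -> : 'D_(v i) (fun q => linv B a q (fun j => v (lift i j))) p =
    tm (v i) * - La (fun j => dltrans B (- tm p) *m v (lift i j)).
  exact: (derive_val (is_derive := H)).
by rewrite mulrN mulrN.
Qed.

Definition lie_pfaff B X Y (v : 'I_2 -> pt R) : R :=
  pfaff X Y (ad_star B *m v ord0) (v ord_max) +
  pfaff X Y (v ord0) (ad_star B *m v ord_max).

Definition lie_Re_cvol B X Y (v : 'I_3 -> pt R) : R :=
  \sum_(i < 3) complex.Re (cvol X Y (upd v i (ad_star B *m v i))).

Lemma dext_pfaff B X Y p v : dext (linv B (pfaff_form X Y)) p v =
  - \sum_(i < 3) (-1) ^+ i * (tm (v i) *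
     lie_pfaff B X Y (fun j => dltrans B (- tm p) *m v (lift i j))).
Proof.
by apply: dext_linv => w t; exact: is_derive_pfaff.
Qed.

Lemma dext_Re_cvol B X Y p v : dext (linv B (Re_cvol_form X Y)) p v =
  - \sum_(i < 4) (-1) ^+ i * (tm (v i) *
     lie_Re_cvol B X Y (fun j => dltrans B (- tm p) *m v (lift i j))).
Proof.
by apply: dext_linv => w t; exact: is_derive_Re_cvol.
Qed.

Definition hconst k (T : Type) (z : T) (x : 'I_k -> T) : 'I_k.+1 -> T :=
  fun i => odflt z (omap x (unlift ord0 i)).

Lemma hconst0 k T (z : T) x : @hconst k T z x ord0 = z.
Proof. by rewrite /hconst unlift_none. Qed.

Lemma hconst_lift k T (z : T) x i : @hconst k T z x (lift ord0 i) = x i.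
Proof. by rewrite /hconst liftK. Qed.

(* The components of a closed left-invariant form along R^5 are annihilated by
   the derivation B: evaluate the differential on (X_*, x_1, ..., x_k). *)
Lemma closed_linv_lie B k (a La : ('I_k -> pt R) -> R) (x : 'I_k -> 'cV[R]_5) :
  (forall v t, is_derive t 1 (fun s => a (fun i => dltrans B (- s) *m v i))
                             (- La (fun i => dltrans B (- t) *m v i))) ->
  closed_form (linv B a) -> La (fun i => mkpt 0 (x i)) = 0.
Proof.
move=> Ha /(_ 0 (hconst (mkpt 1 0) (fun i => mkpt 0 (x i)))).
rewrite (dext_linv _ _ Ha) big_ord_recl big1 => [|i _].
  rewrite addr0 expr0 mul1r hconst0 tm_mkpt mul1r.
  move=> /(congr1 -%R); rewrite opprK oppr0.
  move=> H; rewrite -[RHS]H; congr (La _); apply/funext => j.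
  by rewrite tm0 oppr0 dltrans0 mul1mx hconst_lift.
by rewrite hconst_lift tm_mkpt mul0r mulr0.
Qed.

Lemma closed_pfaff_lie B X Y (x y : 'cV[R]_5) :
  closed_form (linv B (pfaff_form X Y)) ->
  pfaff X Y (mkpt 0 (B *m x)) (mkpt 0 y) +
  pfaff X Y (mkpt 0 x) (mkpt 0 (B *m y)) = 0.
Proof.
move=> H; have := @closed_linv_lie B 2 (pfaff_form X Y) (lie_pfaff B X Y)
  (fun i => if i == ord0 then x else y) _ H.
rewrite /lie_pfaff /= !ad_starE !sp_mkpt; apply=> v t.
exact: is_derive_pfaff.
Qed.

Lemma closed_Re_cvol_lie B X Y (x : 'I_3 -> 'cV[R]_5) :
  closed_form (linv B (Re_cvol_form X Y)) ->
  \sum_(i < 3) complex.Re (cvol X Y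
     (upd (fun j => mkpt 0 (x j)) i (mkpt 0 (B *m x i)))) = 0.
Proof.
move=> H; have := @closed_linv_lie B 3 (Re_cvol_form X Y) (lie_Re_cvol B X Y)
  x _ H.
rewrite /lie_Re_cvol; under eq_bigr do rewrite ad_starE sp_mkpt.
apply=> v t; exact: is_derive_Re_cvol.
Qed.

(* The rows of Q are covectors (a, b, h, c, d) on R^5, numbered from 0 in
   [coord]; the coframe is theta^1 = dt + i h, theta^2 = a + i c,
   theta^3 = b + i d. *)
Definition adapted Q : 'M[R]_(3 + 3, 1 + 5) :=
  (block_mx 1%:M 0 0 Q : 'M[R]_(1 + 5)).
Definition adaptedX Q : 'M[R]_(3, 6) := usubmx (adapted Q).
Definition adaptedY Q : 'M[R]_(3, 6) := dsubmx (adapted Q).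

Definition coord Q (x : 'cV[R]_5) (i : nat) : R := (Q *m x) (inord i) ord0.

Lemma mkpt_entry t (x : 'cV[R]_5) (i : 'I_(1 + 5)) :
  mkpt t x i ord0 = if val i is j.+1 then x (inord j) ord0 else t.
Proof.
rewrite mxE; case: splitP => j ij.
  by have -> : val i = 0 by [rewrite [LHS]ij ord1]; rewrite mxE ord1 mulr1n.
by have -> : val i = j.+1 by []; rewrite inord_val.
Qed.

Lemma adaptedXE Q u (a : 'I_3) : (adaptedX Q *m u) a ord0 =
  if val a is j.+1 then coord Q (sp u) j else tm u.
Proof.
have -> : adaptedX Q *m u = usubmx (mkpt (tm u) (Q *m sp u) : 'M[R]_(3 + 3, 1)).
  by rewrite /adaptedX mul_usub_mx /adapted mul_block_mkpt mul1r.
by rewrite mxE; exact: mkpt_entry.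
Qed.

Lemma adaptedYE Q u (a : 'I_3) : (adaptedY Q *m u) a ord0 =
  coord Q (sp u) (a + 2).
Proof.
have -> : adaptedY Q *m u = dsubmx (mkpt (tm u) (Q *m sp u) : 'M[R]_(3 + 3, 1)).
  by rewrite /adaptedY mul_dsub_mx /adapted mul_block_mkpt mul1r.
by rewrite mxE addnC; exact: mkpt_entry.
Qed.

Definition sig Q (x y : 'cV[R]_5) : R :=
  coord Q x 0 * coord Q y 3 - coord Q x 3 * coord Q y 0 +
  (coord Q x 1 * coord Q y 4 - coord Q x 4 * coord Q y 1).

Lemma pfaff_adapted Q u v : pfaff (adaptedX Q) (adaptedY Q) u v =
  tm u * coord Q (sp v) 2 - coord Q (sp u) 2 * tm v + sig Q (sp u) (sp v).
Proof.
rewrite /pfaff !big_ord_recl big_ord0 !adaptedXE !adaptedYE /= /sig.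
rewrite /bump /=; ring.
Qed.

(** The summand dt/\h of omega contributes only a multiple of dt/\dt, so the condition concerns a/\c
    + b/\d alone. *)
Lemma closed_linv_pfaff B Q :
  (forall x y, sig Q (B *m x) y + sig Q x (B *m y) = 0) ->
  closed_form (linv B (pfaff_form (adaptedX Q) (adaptedY Q))).
Proof.
move=> H p v; rewrite dext_pfaff sum3 /lie_pfaff.
rewrite !pfaff_adapted !ad_starE !tm_mkpt !sp_mkpt !tm_dltrans.
rewrite !mul0r !mulr0 !sub0r !subr0.
rewrite !lift_inord /= !inordK // /bump /=.
have H' x y : sig Q (B *m x) y = - sig Q x (B *m y).
  by apply/eqP; rewrite -addr_eq0 H.
by rewrite !H'; ring.
Qed.

(* sl(2,C) acting on (z, w) = (a - i b, c + i d) with matrix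
   [[a1 + i a2, b1 + i b2], [c1 + i c2, - a1 - i a2]], in the real coordinates
   (a, b, h, c, d). *)
Definition sl2C_mx (a1 a2 b1 b2 c1 c2 : R) : 'M[R]_5 :=
  mx5 [:: [:: a1; a2; 0; b1; - b2]; [:: - a2; a1; 0; - b2; - b1];
          [:: 0; 0; 0; 0; 0];
          [:: c1; c2; 0; - a1; a2]; [:: c2; - c1; 0; - a2; - a1]].

Lemma coord_mul Q B N x : Q *m B = N *m Q ->
  forall i, coord Q (B *m x) i = (N *m (Q *m x)) (inord i) ord0.
Proof. by move=> QB i; rewrite /coord mulmxA QB mulmxA. Qed.

Lemma coord_sl2C Q B a1 a2 b1 b2 c1 c2 x :
  Q *m B = sl2C_mx a1 a2 b1 b2 c1 c2 *m Q ->
  let q := coord Q x in let q' := coord Q (B *m x) in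
  [/\ q' 0 = a1 * q 0 + a2 * q 1 + b1 * q 3 - b2 * q 4,
      q' 1 = - a2 * q 0 + a1 * q 1 - b2 * q 3 - b1 * q 4,
      q' 2 = 0,
      q' 3 = c1 * q 0 + c2 * q 1 - a1 * q 3 + a2 * q 4
    & q' 4 = c2 * q 0 - c1 * q 1 - a2 * q 3 - a1 * q 4].
Proof.
move=> /(coord_mul x) E q q'; rewrite /q' !E.
have F N i : (N *m (Q *m x)) i ord0 =
    N i (inord 0) * q 0 + N i (inord 1) * q 1 + N i (inord 2) * q 2 +
    N i (inord 3) * q 3 + N i (inord 4) * q 4.
  by rewrite mxE sum5.
by rewrite !F !mxE !inordK //=; split; ring.
Qed.

(** [sig] is the real part of dz/\dw, and a traceless complex matrix annihilates dz/\dw. *)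
Lemma sl2C_sig Q B a1 a2 b1 b2 c1 c2 x y :
  Q *m B = sl2C_mx a1 a2 b1 b2 c1 c2 *m Q ->
  sig Q (B *m x) y + sig Q x (B *m y) = 0.
Proof.
move=> QB; rewrite /sig.
have [-> -> _ -> ->] := coord_sl2C x QB.
have [-> -> _ -> ->] := coord_sl2C y QB.
ring.
Qed.

Definition Re_vol_adapted (s : nat -> R) (q : nat -> nat -> R) : R :=
  Re_det3 (fun a i => if a is j.+1 then q i j else s i)
          (fun a i => q i (a + 2)%N).

Lemma Re_cvol_adapted Q (v : 'I_3 -> pt R) :
  complex.Re (cvol (adaptedX Q) (adaptedY Q) v) =
  Re_vol_adapted (fun i => tm (v (inord i)))
                 (fun i => coord Q (sp (v (inord i)))).
Proof.
by rewrite Re_cvol /Re_vol_adapted /Re_det3 !adaptedXE !adaptedYE /= !inordK.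
Qed.

Lemma lie_Re_cvol_adapted Q B (v : 'I_3 -> pt R) :
  let s i := tm (v (inord i)) in let q i := coord Q (sp (v (inord i))) in
  let q' i := coord Q (B *m sp (v (inord i))) in
  let term k := Re_vol_adapted (fun i => if i == k then 0 else s i)
                               (fun i => if i == k then q' i else q i) in
  lie_Re_cvol B (adaptedX Q) (adaptedY Q) v = term 0%N + term 1%N + term 2%N.
Proof.
rewrite /lie_Re_cvol sum3 !Re_cvol_adapted /Re_vol_adapted /Re_det3 /upd /=.
have E k l : (k < 3)%N -> (l < 3)%N -> (inord k == inord l :> 'I_3) = (k == l).
  by move=> k3 l3; rewrite -val_eqE /= !inordK.
by rewrite !E //= !ad_starE !tm_mkpt !sp_mkpt.
Qed.

(** The sum is dt /\ L (Re Psi). Terms of Re Psi containing dt drop out; what remains is -h/\Im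
    (dz/\dw), and B annihilates both h and dz/\dw. *)
Lemma lie_Re_cvol_closed Q B a1 a2 b1 b2 c1 c2 (w : 'I_4 -> pt R) :
  Q *m B = sl2C_mx a1 a2 b1 b2 c1 c2 *m Q ->
  \sum_(i < 4) (-1) ^+ i * (tm (w i) *
    lie_Re_cvol B (adaptedX Q) (adaptedY Q) (fun j => w (lift i j))) = 0.
Proof.
move=> QB; rewrite sum4 !lie_Re_cvol_adapted /Re_vol_adapted /Re_det3 /=.
rewrite !lift_inord /= !inordK // /bump /=.
have [] := coord_sl2C (sp (w (inord 0))) QB => -> -> -> -> ->.
have [] := coord_sl2C (sp (w (inord 1))) QB => -> -> -> -> ->.
have [] := coord_sl2C (sp (w (inord 2))) QB => -> -> -> -> ->.
have [] := coord_sl2C (sp (w (inord 3))) QB => -> -> -> -> ->.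
ring.
Qed.

Lemma closed_linv_Re_cvol Q B a1 a2 b1 b2 c1 c2 :
  Q *m B = sl2C_mx a1 a2 b1 b2 c1 c2 *m Q ->
  closed_form (linv B (Re_cvol_form (adaptedX Q) (adaptedY Q))).
Proof.
move=> QB p v; rewrite dext_Re_cvol.
under eq_bigr do rewrite -(tm_dltrans B (- tm p)).
by rewrite (lie_Re_cvol_closed (fun k => dltrans B (- tm p) *m v k) QB) oppr0.
Qed.

End ClosedForms.

(** * The square of a 2-form *)

Section WedgeSquare.
Variable R : realType.

(** A permutation amounts to the image of 0 and a permutation of the other points. Iterated, this
    lists the 24 terms of the wedge square. *)
Lemma sum_perm_lift (V : nmodType) n (F : 'S_n.+1 -> V) :
  \sum_(s : 'S_n.+1) F s =
  \sum_(i < n.+1) \sum_(s : 'S_n) F (lift_perm ord0 i s).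
Proof.
pose h (x : 'I_n.+1 * 'S_n) := lift_perm ord0 x.1 x.2.
have h_inj : injective h.
  move=> [i s] [j t] E; rewrite /h /= in E.
  have ij : i = j by rewrite -(lift_perm_id ord0 i s) E lift_perm_id.
  rewrite -ij in E *; congr pair; apply/permP => k; apply: (@lift_inj _ i).
  by rewrite -!(lift_perm_lift ord0) E.
have h_bij : bijective h.
  apply: inj_card_bij => //.
  by rewrite card_prod card_ord !card_Sn factS.
by rewrite (reindex h) ?pair_big//; exact: onW_bij.
Qed.

Lemma sum_S1 (V : nmodType) (F : 'S_1 -> V) : \sum_(s : 'S_1) F s = F 1%g.
Proof. by apply: big_pred1 => s; rewrite /= permS1 eqxx. Qed.

Lemma upd_vpair0 (u v x : pt R) : upd (vpair u v) ord0 x = vpair x v.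
Proof. by apply/funext => i; rewrite /upd /vpair; case: eqP. Qed.

Lemma upd_vpair1 (u v x : pt R) : upd (vpair u v) ord_max x = vpair u x.
Proof. by apply/funext => -[[|[|//]] i2]. Qed.

Lemma is_form_anti (w : field R 2 R) p u v : is_form w ->
  w p (vpair u v) = - w p (vpair v u).
Proof.
move=> fw; have alt z : w p (vpair z z) = 0.
  by have [_ /(_ ord0 ord_max)] := fw p (vpair z z); apply.
have [H _] := fw p (vpair (u + v) (u + v)).
have [H1 _] := fw p (vpair u (u + v)).
have [H2 _] := fw p (vpair v (u + v)).
apply/eqP; rewrite -addr_eq0; apply/eqP.
have := H ord0 1 u v; rewrite !upd_vpair0 scale1r mul1r alt.
have := H1 ord_max 1 u v; rewrite !upd_vpair1 scale1r mul1r alt add0r => ->.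
have := H2 ord_max 1 u v; rewrite !upd_vpair1 scale1r mul1r alt addr0 => ->.
by move=> ->.
Qed.

(** Each of the three pairings of four vectors arises from 8 permutations, and the normalisation
    divides by 2! 2! = 4: hence the factor 2. *)
Lemma wedge_square (w : field R 2 R) p (v : 'I_4 -> pt R) : is_form w ->
  let W a b := w p (vpair (v (inord a)) (v (inord b))) in
  wedge w w p v =
  2 * (W 0%N 1%N * W 2%N 3%N - W 0%N 2%N * W 1%N 3%N + W 0%N 3%N * W 1%N 2%N).
Proof.
move=> fw W; pose W' a b := w p (vpair (v a) (v b)).
have anti a b : W' a b = - W' b a by exact: is_form_anti.
rewrite /wedge.
pose i1 : 'I_4 := lift ord0 ord0.
pose i2 : 'I_4 := lift ord0 (lift ord0 ord0).
pose i3 : 'I_4 := lift ord0 (lift ord0 (lift ord0 ord0)).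
pose F (s : 'S_4) : R := (-1) ^+ s * W' (s ord0) (s i1) * W' (s i2) (s i3).
have -> : \sum_(s : 'S_(2 + 2)) (-1) ^+ s * w p (fun i => v (s (lshift 2 i))) *
    w p (fun i => v (s (rshift 2 i))) = \sum_(s : 'S_4) F s.
  apply: eq_bigr => s _; rewrite /F /W'.
  by congr (_ * _ * _); rewrite [X in w p X = _]vpairE;
    congr (w p (vpair (v (s _)) (v (s _)))); apply: val_inj.
rewrite sum_perm_lift sum4 !sum_perm_lift !sum3 !sum_perm_lift !sum2.
rewrite !sum_S1.
rewrite /F /i1 /i2 /i3.
rewrite !(lift_perm_id, lift_perm_lift, odd_lift_perm, perm1, odd_perm1).
rewrite !lift_inord /= !inordK // /bump /= !(addn0, add0n, add1n).
rewrite (anti (inord 1) (inord 0)) (anti (inord 2) (inord 0)).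
rewrite (anti (inord 3) (inord 0)) (anti (inord 2) (inord 1)).
rewrite (anti (inord 3) (inord 1)) (anti (inord 3) (inord 2)).
rewrite (_ : (2`! * 2`!)%N = 4%N) //; rewrite /W -!/(W' _ _).
rewrite !expr0 !expr1.
move: (W' _ _) (W' _ _) (W' _ _) (W' _ _) (W' _ _) (W' _ _).
move=> x1 x2 x3 x4 x5 x6.
by field.
Qed.

(* Each term of d(w /\ w) pairs a value of w with a value of dw. *)
Lemma closed_wedge_square (w : field R 2 R) : is_form w -> closed_form w ->
  (forall p u v z, derivable (fun q => w q (vpair u v)) p z) ->
  closed_form (wedge w w).
Proof.
move=> fw cw dw p v; rewrite /dext.
pose W (a b : nat) q := w q (vpair (v (inord a)) (v (inord b))).
pose D (c a b : nat) : R := 'D_(v (inord c)) (W a b) p.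
have dW c a b : is_derive p (v (inord c)) (W a b) (D c a b).
  by apply: DeriveDef; first exact: dw.
have anti c a b : D c a b = - D c b a.
  have -> : D c a b = 'D_(v (inord c)) (- W b a) p.
    by congr ('D_(_) _ p); apply/funext => q; exact: is_form_anti.
  exact: derive_val.
(* Closedness of [w] on three constant vector fields, solved for one of the three derivatives. *)
have cyc c a b : D c a b = D b a c - D a b c.
  rewrite (anti b) (anti a) opprK addrC.
  pose u (i : 'I_3) := nth 0 [:: v (inord c); v (inord a); v (inord b)] i.
  have face (i : 'I_3) : 'D_(u i) (fun q => w q (fun j => u (lift i j))) p =
      'D_(u i) (fun q => w q (vpair (u (lift i ord0)) (u (lift i ord_max)))) p.
    congr ('D_(u i) _ p); apply/funext => q; congr (w q _); exact: vpairE.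
  have := cw p u; rewrite /dext; under eq_bigr do rewrite face.
  rewrite sum3.
  rewrite !lift_inord /u /= !inordK // /bump /=.
  move=> H; apply/eqP; rewrite -subr_eq0; apply/eqP; rewrite -[RHS]H /D /W.
  by rewrite addn0 (_ : (1 + 1)%N = 2%N)//; ring.
have H k a b c d : (k < 5)%N ->
    lift (inord k : 'I_5) (inord 0 : 'I_4) = inord a ->
    lift (inord k : 'I_5) (inord 1 : 'I_4) = inord b ->
    lift (inord k : 'I_5) (inord 2 : 'I_4) = inord c ->
    lift (inord k : 'I_5) (inord 3 : 'I_4) = inord d ->
  'D_(v (inord k)) (fun q => wedge w w q (fun j => v (lift (inord k) j))) p =
  2 * (D k a b * W c d p + W a b p * D k c d
     - (D k a c * W b d p + W a c p * D k b d)
     + (D k a d * W b c p + W a d p * D k b c)).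
  move=> k5 Ea Eb Ec Ed.
  have -> : (fun q => wedge w w q (fun j => v (lift (inord k) j))) =
      2 *: (W a b * W c d - W a c * W b d + W a d * W b c).
    by apply/funext => q; rewrite wedge_square// Ea Eb Ec Ed.
  have P x y z t := is_deriveM (dW k x y) (dW k z t).
  have := @is_deriveZ _ _ _ _ 2 _ _ _
    (is_deriveD (is_deriveB (P a b c d) (P a c b d)) (P a d b c)).
  move=> /(fun h => derive_val (is_derive := h)) ->.
  by rewrite /GRing.scale /=; ring.
rewrite sum5.
rewrite (H 0 1 2 3 4)%N ?(H 1 0 2 3 4)%N ?(H 2 0 1 3 4)%N ?(H 3 0 1 2 4)%N
  ?(H 4 0 1 2 3)%N //; try by rewrite lift_inord /= !inordK.
rewrite !inordK //.
(* One relation for each of the ten triples of indices, eliminating the derivative along the vector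
   of largest index. *)
rewrite (cyc 2 0 1)%N (cyc 3 0 1)%N (cyc 4 0 1)%N (cyc 3 0 2)%N (cyc 4 0 2)%N
 (cyc 4 0 3)%N (cyc 3 1 2)%N (cyc 4 1 2)%N (cyc 4 1 3)%N (cyc 4 2 3)%N.
pose V a b : R := W a b p; rewrite -!/(V _ _).
clear; move: D V => D V; ring.
Qed.
End WedgeSquare.

(** * The SU(3)-structure of an adapted coframe *)

Section AdaptedStructures.
Variable R : realType.
Implicit Types (B Q : 'M[R]_5) (t : R).

Definition std_form B Q : field R 2 R :=
  linv B (pfaff_form (adaptedX Q) (adaptedY Q)).

Lemma std_formE B Q p v : std_form B Q p v =
  pfaff (adaptedX Q) (adaptedY Q) (dltrans B (- tm p) *m v ord0)
                                  (dltrans B (- tm p) *m v ord_max).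
Proof. by []. Qed.

Lemma pfaff_linear_l (X Y : 'M[R]_(3, 6)) a u v w :
  pfaff X Y (a *: u + v) w = a * pfaff X Y u w + pfaff X Y v w.
Proof.
rewrite /pfaff mulr_sumr -big_split /=; apply: eq_bigr => i _.
have L (M : 'M[R]_(3, 6)) :
    (M *m (a *: u + v)) i ord0 = a * (M *m u) i ord0 + (M *m v) i ord0.
  by rewrite mulmxDr -scalemxAr !mxE.
by rewrite !L; ring.
Qed.

Lemma pfaff_anti (X Y : 'M[R]_(3, 6)) u v : pfaff X Y u v = - pfaff X Y v u.
Proof. by rewrite /pfaff -sumrN; apply: eq_bigr => i _; ring. Qed.

Lemma pfaff_alt (X Y : 'M[R]_(3, 6)) u : pfaff X Y u u = 0.
Proof. by rewrite /pfaff big1 // => i _; ring. Qed.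

Lemma std_form_is_form B Q : is_form (std_form B Q).
Proof.
move=> p v; split.
  move=> i a x y; rewrite !std_formE /upd.
  case: i => [[|[|//]]] i2 /=.
    by rewrite /= mulmxDr -scalemxAr pfaff_linear_l.
  rewrite /= mulmxDr -scalemxAr !(pfaff_anti _ _ (_ *m v _)) pfaff_linear_l.
  ring.
move=> i j ij vij; rewrite std_formE.
suff -> : v ord0 = v ord_max by rewrite pfaff_alt.
have E (k : 'I_2) : k = if val k == 0%N then ord0 else ord_max.
  by case: k => [[|[|//]]] k2; exact: val_inj.
move: ij vij; rewrite (E i) (E j).
by case: ifP; case: ifP; rewrite ?eqxx// => _ _ _ ->.
Qed.

Lemma adapted_unit Q : Q \in unitmx -> (adapted Q : 'M[R]_6) \in unitmx.
Proof.
move=> Qu; rewrite /adapted unitmxE (det_lblock (1%:M : 'M[R]_1)).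
by rewrite det1 mul1r -unitmxE.
Qed.

Lemma dltrans_unit B t : dltrans B t \in unitmx.
Proof.
have H : dltrans B t *m dltrans B (- t) = 1%:M.
  by rewrite -dltransD subrr dltrans0.
exact: (mulmx1_unit H).1.
Qed.

Lemma coord_eq0 Q (x : 'cV[R]_5) : Q \in unitmx ->
  (forall i : 'I_5, coord Q x i = 0) -> x = 0.
Proof.
move=> Qu H; rewrite -(mulKmx Qu x) (_ : Q *m x = 0) ?mulmx0//.
by apply/colP => i; rewrite [RHS]mxE -(H i) /coord inord_val ord1.
Qed.

Lemma coord_inv Q i (j : nat) : Q \in unitmx -> (j < 5)%N ->
  coord Q (invmx Q *m delta_mx i ord0) j = (j == i)%:R.
Proof.
move=> Qu j5; rewrite /coord mulKVmx// mxE eqxx andbT.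
by rewrite -val_eqE /= inordK.
Qed.

Lemma std_form_nondegenerate B Q : Q \in unitmx ->
  Defs.nondegenerate (std_form B Q).
Proof.
move=> Qu p u H.
have {}H v : pfaff (adaptedX Q) (adaptedY Q) (dltrans B (- tm p) *m u) v = 0.
  have := H (dltrans B (tm p) *m v); rewrite std_formE /vpair /=.
  by rewrite dltransNK.
have : dltrans B (- tm p) *m u = 0; last first.
  by move/(canRL (mulKmx (dltrans_unit _ _))); rewrite mulmx0.
move: (dltrans B (- tm p) *m u) H => {}u H.
(* The basis dual to the rows of [Q]. Pairing u with these vectors and with X_* reads off its six
   coordinates. *)
pose e i := mkpt 0 (invmx Q *m delta_mx (inord i) ord0 : 'cV[R]_5).
have := H (mkpt 1 0); have := H (e 0%N); have := H (e 1%N); have := H (e 2%N).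
have := H (e 3%N); have := H (e 4%N).
rewrite !pfaff_adapted !tm_mkpt !sp_mkpt /sig !coord_inv// !inordK//=.
have E i : coord Q (0 : 'cV[R]_5) i = 0 by rewrite /coord mulmx0 mxE.
rewrite !E ?(mulr0, mulr1, add0r, addr0, sub0r, subr0).
move=> h4 h3 h2 h1 h0 h.
rewrite -(mkptE u) (_ : tm u = 0) // (_ : sp u = 0).
  by rewrite /mkpt (raddf0 (@scalar_mx R 1)) col_mx0.
apply: (coord_eq0 Qu) => -[[|[|[|[|[|//]]]]]] /= _; lra.
Qed.

Lemma std_form_left_inv B Q : left_inv B (std_form B Q).
Proof. exact: linv_left_inv. Qed.

Lemma std_form_symplectic B Q : Q \in unitmx ->
  (forall x y, sig Q (B *m x) y + sig Q x (B *m y) = 0) ->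
  symplectic (std_form B Q).
Proof.
move=> Qu H; split; [exact: std_form_is_form | exact: closed_linv_pfaff |].
exact: std_form_nondegenerate.
Qed.

Lemma std_form_derivable B Q p u v z :
  derivable (fun q => std_form B Q q (vpair u v)) p z.
Proof.
have H := is_derive_pfaff B (adaptedX Q) (adaptedY Q) u v (tm p).
by have [] := derive_tm z H.
Qed.

(** The equation theta o J = i theta means X J = -Y and Y J = X; it is solved by inverting the
    coframe. *)
Definition adapted_J Q (u : pt R) : pt R := invmx (adapted Q : 'M[R]_6) *m
  (col_mx (- (adaptedY Q *m u)) (adaptedX Q *m u) : 'cV[R]_(3 + 3)).

Definition std_J B Q : pt R -> pt R -> pt R := fun p v =>
  dltrans B (tm p) *m adapted_J Q (dltrans B (- tm p) *m v).

Lemma coframe_adapted_J Q u a : Q \in unitmx ->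
  coframe (adaptedX Q) (adaptedY Q) a (adapted_J Q u) =
  ('i%C * coframe (adaptedX Q) (adaptedY Q) a u)%C.
Proof.
move=> Qu; rewrite /coframe /adapted_J; set c := col_mx _ _.
have E : adapted Q *m (invmx (adapted Q : 'M[R]_6) *m c) = c.
  by apply: mulKVmx; exact: adapted_unit.
have -> : adaptedX Q *m (invmx (adapted Q : 'M[R]_6) *m c) = usubmx c.
  by rewrite -[in RHS]E -mul_usub_mx.
have -> : adaptedY Q *m (invmx (adapted Q : 'M[R]_6) *m c) = dsubmx c.
  by rewrite -[in RHS]E -mul_dsub_mx.
by rewrite col_mxKu col_mxKd mxE; simpc.
Qed.

Lemma coframe_mul (X Y : 'M[R]_(3, 6)) (M : 'M[R]_6) a (u : pt R) :
  coframe (X *m M) (Y *m M) a u = coframe X Y a (M *m u).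
Proof. by rewrite /coframe -!mulmxA. Qed.

(** Sufficiency half of the criterion. One coframe at the identity, transported by left
    translations, supplies all three tensors; omega/\omega is closed because omega is. *)
Lemma half_flat_std_form B Q a1 a2 b1 b2 c1 c2 : Q \in unitmx ->
  Q *m B = sl2C_mx a1 a2 b1 b2 c1 c2 *m Q -> half_flat B (std_form B Q).
Proof.
move=> Qu QB; exists (std_J B Q), (linv B (cvol (adaptedX Q) (adaptedY Q))).
split.
- move=> p; exists (adaptedX Q *m dltrans B (- tm p)),
    (adaptedY Q *m dltrans B (- tm p)); split.
  + rewrite -mul_col_mx vsubmxK unitmx_mul adapted_unit//.
    exact: dltrans_unit.
  + by move=> u v; rewrite std_formE /vpair /= /pfaff -!mulmxA.
  + move=> a v; rewrite !coframe_mul /std_J.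
    by rewrite (dltransNK B (tm p)) coframe_adapted_J.
  + move=> v; rewrite /linv /cvol; congr (\det _).
    by apply/matrixP => a b; rewrite !mxE coframe_mul.
- split; [exact: linv_left_inv | | exact: linv_left_inv].
  move=> g p v; rewrite !derive_ltrans /std_J tm_ltrans.
  have E : dltrans B (- (tm g + tm p)) *m (dltrans B (tm g) *m v) =
      dltrans B (- tm p) *m v.
    by rewrite mulmxA -(dltransD B (- (tm g + tm p))) opprD addrAC addNr add0r.
  transitivity
    (dltrans B (tm g + tm p) *m adapted_J Q (dltrans B (- tm p) *m v)).
    by congr (_ *m adapted_J Q _).
  by rewrite (dltransD B (tm g) (tm p)); apply/esym; exact: mulmxA.
- apply: closed_wedge_square;
    [exact: std_form_is_form | | exact: std_form_derivable].
  by apply: closed_linv_pfaff => x y; exact: sl2C_sig QB.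
- exact: closed_linv_Re_cvol QB.
Qed.

End AdaptedStructures.

(** * Normalisation by SU(3) *)

Section SpecialUnitary.
Local Open Scope sesquilinear_scope.
Variable C : numClosedFieldType.

Lemma unitarymx_det n (V : 'M[C]_n) : V \is unitarymx -> `|\det V| = 1.
Proof.
move=> /unitarymxP /(congr1 determinant).
rewrite det_mulmx det1 det_map_mx det_tr -normCK => /eqP.
by rewrite pexpr_eq1// => /eqP.
Qed.

(** Gram-Schmidt gives a unitary matrix whose first row spans the line of c. Its phase and its
    determinant are then corrected in two different rows, whence the size n + 2. *)
Lemma special_unitary_row n (c : 'rV[C]_n.+2) : c != 0 ->
  exists U : 'M[C]_n.+2, exists2 r : C, 0 < r &
    [/\ U \is unitarymx, \det U = 1 & row ord0 U = r *: c].
Proof.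
move=> c0; pose V := schmidt (\matrix_(i < n.+2) c).
have Vu : V \is unitarymx by exact: schmidt_unitarymx.
have /sub_rVP[l cl] : (c <= row ord0 V)%MS.
  have := row_schmidt_sub (\matrix_(i < n.+2) c) ord0; rewrite rowK.
  rewrite (big_pred1 ord0) ?genmxE// => k.
  by rewrite leqn0.
have l0 : l != 0 by apply: contra_neq c0 => l0; rewrite cl l0 scale0r.
have nl0 : 0 < `|l| by rewrite normr_gt0.
pose u := l / `|l|.
have nu : `|u| = 1 by rewrite normrM normfV normr_id divff// lt0r_neq0.
(* [u] makes the first row a positive multiple of c; the last entry absorbs the determinant without
   touching that row. *)
pose d (i : 'I_n.+2) :=
  if i == ord0 then u else if i == ord_max then (u * \det V)^-1 else 1.
have nd i : `|d i| = 1.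
  rewrite /d; case: ifP => // _; case: ifP => _; last by rewrite normr1.
  by rewrite normfV normrM nu unitarymx_det// mulr1 invr1.
pose D := diag_mx (\row_i d i).
have Du : D \is unitarymx.
  apply/unitarymxP; apply/matrixP => i j; rewrite !mxE (bigD1 j)//= big1 ?addr0.
    rewrite !mxE eqxx mulr1n; case: eqP => [->|_]; last by rewrite mulr0n mul0r.
    by rewrite mulr1n -normCK nd expr1n.
  by move=> k kj; rewrite !mxE [j == k]eq_sym (negPf kj) mulr0n rmorph0 mulr0.
have u0 : u != 0 by rewrite -normr_gt0 nu.
have V0 : \det V != 0 by rewrite -normr_gt0 unitarymx_det.
exists (D *m V), `|l|^-1; first by rewrite invr_gt0.
split.
- exact: mul_unitarymx.
- rewrite det_mulmx det_diag.
  rewrite (bigD1 ord0)//= (bigD1 ord_max)//= big1 ?mulr1.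
    by rewrite !mxE /d !eqxx /= invfM mulrA mulfV// mul1r mulVf.
  by move=> i /andP[i0 im]; rewrite mxE /d (negPf i0) (negPf im).
- rewrite row_mul row_diag_mx mxE -scalemxAl -rowE /d eqxx cl scalerA /u.
  by rewrite mulrC.
Qed.

End SpecialUnitary.

Section Normalisation.
Local Open Scope sesquilinear_scope.
Variable R : realType.
Implicit Types (X Y : 'M[R]_(3, 6)).

Definition toC m n (M : 'M[R]_(m, n)) : 'M[R[i]]_(m, n) :=
  map_mx (real_complex R) M.

Definition cmx m n (X Y : 'M[R]_(m, n)) : 'M[R[i]]_(m, n) :=
  toC X + 'i%C *: toC Y.

Lemma cmxE m n (X Y : 'M[R]_(m, n)) i j : cmx X Y i j = (X i j +i* Y i j)%C.
Proof. by rewrite !mxE [RHS]complexE. Qed.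

Lemma coframeE X Y a (v : pt R) :
  coframe X Y a v = (cmx X Y *m toC v) a ord0.
Proof.
transitivity (cmx (X *m v) (Y *m v) a ord0); first by rewrite cmxE.
by rewrite /cmx mulmxDl -scalemxAl /toC !map_mxM.
Qed.

Lemma cmx_ReIm m n (M : 'M[R[i]]_(m, n)) :
  cmx (map_mx (@complex.Re R) M) (map_mx (@complex.Im R) M) = M.
Proof. by apply/matrixP => i j; rewrite cmxE !mxE; case: (M i j). Qed.

Definition rotX (U : 'M[R[i]]_3) X Y := map_mx (@complex.Re R) (U *m cmx X Y).
Definition rotY (U : 'M[R[i]]_3) X Y := map_mx (@complex.Im R) (U *m cmx X Y).

Lemma coframe_rot U X Y a (v : pt R) : coframe (rotX U X Y) (rotY U X Y) a v =
  \sum_b U a b * coframe X Y b v.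
Proof.
rewrite coframeE cmx_ReIm -mulmxA mxE; apply: eq_bigr => b _.
by rewrite -coframeE.
Qed.

Definition cocol X Y (v : pt R) : 'cV[R[i]]_3 := \col_a coframe X Y a v.

(** omega is the imaginary part of the Hermitian form of the coframe, which makes its invariance
    under U(3) visible. *)
Lemma pfaffE X Y u v :
  pfaff X Y u v = complex.Im (((cocol X Y u)^t* *m cocol X Y v) ord0 ord0).
Proof.
rewrite [in RHS]mxE raddf_sum /pfaff; apply: eq_bigr => a _.
transitivity (complex.Im ((coframe X Y a u)^*%C * coframe X Y a v)).
  by rewrite /coframe /=; ring.
by rewrite !mxE.
Qed.

Lemma pfaff_rot U X Y u v : U \is unitarymx ->
  pfaff (rotX U X Y) (rotY U X Y) u v = pfaff X Y u v.
Proof.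
move=> /unitarymxP /mulmx1C UU.
have E w : cocol (rotX U X Y) (rotY U X Y) w = U *m cocol X Y w.
  apply/colP => a; rewrite !mxE coframe_rot; apply: eq_bigr => b _.
  by rewrite mxE.
rewrite !pfaffE !E trmx_mul map_mxM; congr (complex.Im (fun_of_matrix _ _ _)).
by rewrite -mulmxA (mulmxA _ U) UU mul1mx.
Qed.

Lemma cvol_rot U X Y v : \det U = 1 ->
  cvol (rotX U X Y) (rotY U X Y) v = cvol X Y v.
Proof.
move=> U1; rewrite /cvol -[RHS]mul1r -U1 -det_mulmx; congr (\det _).
apply/matrixP => a b; rewrite !mxE coframe_rot; apply: eq_bigr => k _.
by rewrite mxE.
Qed.

Lemma unitmx_inj n (A : 'M[R]_n) : (forall v : 'cV_n, A *m v = 0 -> v = 0) ->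
  A \in unitmx.
Proof.
move=> H; rewrite -unitmx_tr -row_free_unit; apply: inj_row_free => v vA.
apply: trmx_inj; rewrite trmx0; apply: H.
by rewrite -[A]trmxK -trmx_mul vA trmx0.
Qed.

(** Re ((c - i d)(X + i Y)) = c X + d Y, which explains the sign in [cmx c (- d)]. *)
Lemma rotX_row0 (c d : 'rV[R]_3) X Y (v : pt R) (r : R) (U : 'M[R[i]]_3) :
  row ord0 U = r%:C%C *: cmx c (- d) ->
  (rotX U X Y *m v) ord0 ord0 = r * ((c *m X + d *m Y) *m v) ord0 ord0.
Proof.
move=> rU; have -> : (rotX U X Y *m v) ord0 ord0 =
    complex.Re (coframe (rotX U X Y) (rotY U X Y) ord0 v) by [].
rewrite coframe_rot.
have E b : U ord0 b = (r * c ord0 b -i* (r * d ord0 b))%C.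
  have /rowP /(_ b) := rU; rewrite mxE => ->.
  by rewrite mxE cmxE mxE; simpc.
under eq_bigr do rewrite E /coframe.
rewrite mulmxDl -!mulmxA mxE ![(_ *m (_ *m v)) _ _]mxE mulrDr !mulr_sumr.
rewrite !big_ord_recl !big_ord0 /=; ring.
Qed.

Lemma adapt_coframe X Y : (col_mx X Y : 'M[R]_6) \in unitmx ->
  exists2 Q : 'M[R]_5, Q \in unitmx &
    (forall x y, pfaff X Y (mkpt 0 x) (mkpt 0 y) = sig Q x y) /\
    (forall x : 'I_3 -> 'cV[R]_5,
       complex.Re (cvol X Y (fun i => mkpt 0 (x i))) =
       Re_vol_adapted (fun=> 0) (fun i => coord Q (x (inord i)))).
Proof.
move=> P1; pose e0 : 'rV[R]_(1 + 5) := row_mx 1%:M 0.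
(* The coordinates of dt in the given real coframe; read as a complex row vector, they dictate the
   first row of the rotation. *)
pose g : 'rV[R]_(3 + 3) := e0 *m invmx (col_mx X Y : 'M[R]_6).
have gE v : (lsubmx g *m X + rsubmx g *m Y) *m v = (tm v)%:M.
  have -> : lsubmx g *m X + rsubmx g *m Y = e0.
    rewrite -mul_row_col hsubmxK; exact: mulmxKV.
  transitivity ((row_mx 1%:M 0 : 'rV[R]_(1 + 5)) *m mkpt (tm v) (sp v)).
    by rewrite mkptE.
  by rewrite /mkpt mul_row_col mul0mx addr0 mul1mx.
have c0 : cmx (lsubmx g) (- rsubmx g) != 0.
  apply: contra_eq_neq (gE (mkpt 1 0)) => /matrixP H.
  have -> : lsubmx g = 0.
    apply/matrixP => i j; have := H i j.
    by rewrite cmxE => /(congr1 (@complex.Re R)); rewrite !mxE.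
  have -> : rsubmx g = 0.
    apply/matrixP => i j; have := H i j.
    rewrite cmxE => /(congr1 (@complex.Im R)).
    by rewrite !mxE /= => /(congr1 -%R); rewrite opprK oppr0.
  rewrite !mul0mx addr0 mul0mx tm_mkpt; apply/eqP => /matrixP /(_ ord0 ord0).
  by rewrite !mxE => /eqP; rewrite eq_sym oner_eq0.
have [U [r r0 [Uu U1 rU]]] := special_unitary_row c0.
have rE : r = (complex.Re r)%:C%C by rewrite RRe_real// ger0_real// ltW.
rewrite rE in rU.
pose X' := rotX U X Y; pose Y' := rotY U X Y.
have X'0 x : (X' *m mkpt 0 x) ord0 ord0 = 0.
  by rewrite (rotX_row0 _ _ _ rU) gE tm_mkpt mxE mul0rn mulr0.
pose P : 'M[R]_(1 + 5) := (col_mx X' Y' : 'M[R]_(3 + 3, 6)).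
(* The first row of [P] vanishes on R^5. Dropping it and the t-column leaves the real parts a, b and
   the imaginary parts h, c, d, in the order that [coord] expects. *)
pose Q := drsubmx P.
pose Pm (m : pt R) : 'cV[R]_(3 + 3) := col_mx (X' *m m) (Y' *m m).
have QE x (j : 'I_5) : (Q *m x) j ord0 = Pm (mkpt 0 x) (rshift 1 j) ord0.
  have -> : Pm (mkpt 0 x) = P *m mkpt 0 x by rewrite /Pm -mul_col_mx.
  transitivity ((P *m mkpt 0 x) (rshift 1 j) ord0); last by [].
  by rewrite -[P]submxK /mkpt mul_block_col col_mxEd raddf0 mulmx0 add0r.
have cX x (a : 'I_3) : (X' *m mkpt 0 x) a ord0 =
    if val a is j.+1 then coord Q x j else 0.
  case: a => [[|j] j3] /=.
    by rewrite -[RHS](X'0 x); congr (fun_of_matrix _ _ _); exact: val_inj.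
  rewrite -[LHS](col_mxEu _ (Y' *m mkpt 0 x)) /coord QE.
  congr (fun_of_matrix _ _ _); apply: val_inj.
  by rewrite /= inordK// (ltn_trans (n := 2)).
have cY x (a : 'I_3) : (Y' *m mkpt 0 x) a ord0 = coord Q x (a + 2).
  rewrite -[LHS](col_mxEd (X' *m mkpt 0 x)) /coord QE.
  congr (fun_of_matrix _ _ _); apply: val_inj.
  have a5 : (a.+2 < 5)%N by rewrite !ltnS -ltnS.
  by rewrite addn2 /= inordK.
exists Q.
  apply: unitmx_inj => x Qx.
  (* A vector of R^5 killed by [Q] is killed by the whole rotated coframe, hence by the original
     one, which is invertible. *)
  have q0 j : coord Q x j = 0 by rewrite /coord Qx mxE.
  have cof0 : cocol X Y (mkpt 0 x) = 0.
    rewrite -[LHS](mulKmx (unitarymx_unit Uu)).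
    rewrite (_ : U *m _ = 0) ?mulmx0//; apply/colP => a.
    transitivity (coframe X' Y' a (mkpt 0 x)).
      by rewrite coframe_rot mxE; apply: eq_bigr => b _; rewrite mxE.
    rewrite /coframe cX cY q0 mxE.
    by case: (val a) => [|k]; rewrite ?q0.
  have X0 : X *m mkpt 0 x = 0.
    apply/colP => a; have /colP /(_ a) := cof0; rewrite !mxE /coframe.
    by move/(congr1 (@complex.Re R)); rewrite /= mxE.
  have Y0 : Y *m mkpt 0 x = 0.
    apply/colP => a; have /colP /(_ a) := cof0; rewrite !mxE /coframe.
    by move/(congr1 (@complex.Im R)); rewrite /= mxE.
  have Pm0 : (col_mx X Y : 'M[R]_6) *m mkpt 0 x = 0.
    transitivity (col_mx (X *m mkpt 0 x) (Y *m mkpt 0 x) : 'cV[R]_(3 + 3)).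
      exact: (@mul_col_mx R 3 3 6 1 X Y (mkpt 0 x)).
    by rewrite X0 Y0 col_mx0.
  by have := congr1 (mulmx (invmx (col_mx X Y : 'M[R]_6))) Pm0;
    rewrite mulmx0 mulKmx// => /(congr1 (@sp R)); rewrite sp_mkpt sp0.
split=> [x y | x].
  rewrite -(pfaff_rot X Y _ _ Uu) /pfaff !big_ord_recl big_ord0.
  rewrite !cX !cY /= /sig /bump /=.
  ring.
rewrite -(cvol_rot X Y _ U1) Re_cvol /Re_vol_adapted /Re_det3.
by rewrite !cX !cY /= !inordK.
Qed.

End Normalisation.

(** * Half-flatness forces an sl(2, C) normal form *)

Section Necessity.
Variable R : realType.
Implicit Types (B Q : 'M[R]_5) (X Y : 'M[R]_(3, 6)).

Ltac coord_ring :=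
  lazy beta iota zeta delta [Re_vol_adapted Re_det3 nth eqn addn Nat.add]; ring.

(** Evaluating on pairs and triples of the dual basis gives nineteen linear equations on the 25
    entries of N = Q B Q^-1; their solutions are the six-parameter family [sl2C_mx]. *)
Lemma sp_lie_sl2C Q B : Q \in unitmx ->
  (forall x y, sig Q (B *m x) y + sig Q x (B *m y) = 0) ->
  (forall x : 'I_3 -> 'cV[R]_5, \sum_(i < 3)
     Re_vol_adapted (fun=> 0) (fun j =>
       coord Q (if inord j == i then B *m x i else x (inord j))) = 0) ->
  exists a1 a2 b1 b2 c1 c2, Q *m B = sl2C_mx a1 a2 b1 b2 c1 c2 *m Q.
Proof.
move=> Qu sigB volB.
pose N := Q *m B *m invmx Q.
pose n (i j : nat) : R := N (inord i) (inord j).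
(* A Kronecker symbol written with [eqn], so that [coord_ring] reduces it to 0 or 1. *)
pose dl (i b : nat) : R := if eqn b i then 1 else 0.
pose e i : 'cV[R]_5 := invmx Q *m delta_mx (inord i) ord0.
have eE i j : (i < 5)%N -> (j < 5)%N -> coord Q (e i) j = dl i j.
  by move=> i5 j5; rewrite /e coord_inv// inordK // /dl -eqnE; case: eqn.
have BeE i j : coord Q (B *m e i) j = n j i.
  by rewrite /coord /e /n /N !mulmxA -colE mxE.
have S i j : (i < 5)%N -> (j < 5)%N ->
    n 0%N i * dl j 3%N - n 3%N i * dl j 0%N +
    (n 1%N i * dl j 4%N - n 4%N i * dl j 1%N) +
    (dl i 0%N * n 3%N j - dl i 3%N * n 0%N j +
    (dl i 1%N * n 4%N j - dl i 4%N * n 1%N j)) = 0.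
  by move=> i5 j5; have := sigB (e i) (e j); rewrite /sig !BeE !eE.
pose vol (q0 q1 q2 : nat -> R) :=
  Re_vol_adapted (fun=> 0) (fun a => nth (fun=> 0) [:: q0; q1; q2] a).
have V i j k : (i < 5)%N -> (j < 5)%N -> (k < 5)%N ->
    vol (n^~ i) (dl j) (dl k) + vol (dl i) (n^~ j) (dl k) +
    vol (dl i) (dl j) (n^~ k) = 0.
  move=> i5 j5 k5; have := volB (fun a => nth 0 [:: e i; e j; e k] a).
  rewrite sum3 /vol /Re_vol_adapted /Re_det3 /=.
  by rewrite -!val_eqE /= !inordK //= !BeE !eE.
have S01 : n 3%N 1%N - n 4%N 0%N = 0.
  by rewrite -[RHS](S 0%N 1%N isT isT) /dl; coord_ring.
have S02 : n 3%N 2%N = 0.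
  by rewrite -[RHS](S 0%N 2%N isT isT) /dl; coord_ring.
have S03 : n 0%N 0%N + n 3%N 3%N = 0.
  by rewrite -[RHS](S 0%N 3%N isT isT) /dl; coord_ring.
have S12 : n 4%N 2%N = 0.
  by rewrite -[RHS](S 1%N 2%N isT isT) /dl; coord_ring.
have S13 : n 0%N 1%N + n 4%N 3%N = 0.
  by rewrite -[RHS](S 1%N 3%N isT isT) /dl; coord_ring.
have S14 : n 1%N 1%N + n 4%N 4%N = 0.
  by rewrite -[RHS](S 1%N 4%N isT isT) /dl; coord_ring.
have S23 : n 0%N 2%N = 0.
  by rewrite -[RHS](S 2%N 3%N isT isT) /dl; coord_ring.
have S24 : n 1%N 2%N = 0.
  by rewrite -[RHS](S 2%N 4%N isT isT) /dl; coord_ring.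
have S34 : n 1%N 3%N - n 0%N 4%N = 0.
  by rewrite -[RHS](S 3%N 4%N isT isT) /dl; coord_ring.
have V012 : - n 3%N 0%N - n 4%N 1%N = 0.
  by rewrite -[RHS](V 0%N 1%N 2%N isT isT isT) /vol /dl; coord_ring.
have V013 : n 2%N 0%N = 0.
  by rewrite -[RHS](V 0%N 1%N 3%N isT isT isT) /vol /dl; coord_ring.
have V014 : n 2%N 1%N = 0.
  by rewrite -[RHS](V 0%N 1%N 4%N isT isT isT) /vol /dl; coord_ring.
have V023 : n 4%N 3%N - n 1%N 0%N = 0.
  by rewrite -[RHS](V 0%N 2%N 3%N isT isT isT) /vol /dl; coord_ring.
have V024 : n 0%N 0%N + n 2%N 2%N + n 4%N 4%N = 0.
  by rewrite -[RHS](V 0%N 2%N 4%N isT isT isT) /vol /dl; coord_ring.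
have V034 : n 2%N 3%N = 0.
  by rewrite -[RHS](V 0%N 3%N 4%N isT isT isT) /vol /dl; coord_ring.
have V123 : - n 1%N 1%N - n 2%N 2%N - n 3%N 3%N = 0.
  by rewrite -[RHS](V 1%N 2%N 3%N isT isT isT) /vol /dl; coord_ring.
have V124 : n 0%N 1%N - n 3%N 4%N = 0.
  by rewrite -[RHS](V 1%N 2%N 4%N isT isT isT) /vol /dl; coord_ring.
have V134 : n 2%N 4%N = 0.
  by rewrite -[RHS](V 1%N 3%N 4%N isT isT isT) /vol /dl; coord_ring.
have V234 : - n 0%N 3%N - n 1%N 4%N = 0.
  by rewrite -[RHS](V 2%N 3%N 4%N isT isT isT) /vol /dl; coord_ring.
(* The four diagonal equations: they force the two diagonal entries of each real 2x2 block to agree,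
   and the h-entry to vanish. *)
have [n00 n22] : n 0%N 0%N = n 1%N 1%N /\ n 2%N 2%N = 0 by lra.
have E := (=^~ n00, n22, S02, S12, S23, S24, V013, V014, V034, V134,
  subr0_eq S34, esym (addr0_eq S03), esym (addr0_eq S14), esym (addr0_eq S13),
  esym (subr0_eq S01), esym (subr0_eq V012), esym (subr0_eq V023),
  esym (subr0_eq V124), esym (subr0_eq V234)).
exists (n 0%N 0%N), (n 0%N 1%N), (n 0%N 3%N), (- n 0%N 4%N).
exists (n 3%N 0%N), (n 3%N 1%N).
suff <- : N = sl2C_mx (n 0%N 0%N) (n 0%N 1%N) (n 0%N 3%N) (- n 0%N 4%N)
    (n 3%N 0%N) (n 3%N 1%N) by rewrite /N mulmxKV.
apply/matrixP => i j; rewrite [RHS]mxE.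
have -> : N i j = n i j by rewrite /n !inord_val.
case: i => [[|[|[|[|[|//]]]]] _] /=; case: j => [[|[|[|[|[|//]]]]] _] /=;
  by rewrite ?E ?opprK.
Qed.

(** Necessity half of the criterion. Left-invariance reduces the structure to its coframe at the
    origin, which [adapt_coframe] normalises; closedness then says that B annihilates both forms on
    R^5. *)
Lemma half_flat_sl2C B w : closed_form w -> half_flat B w ->
  exists2 Q : 'M[R]_5, Q \in unitmx &
    exists a1 a2 b1 b2 c1 c2, Q *m B = sl2C_mx a1 a2 b1 b2 c1 c2 *m Q.
Proof.
move=> cw [J [Psi [su3 [wB _ PsiB] _ cPsi]]].
have [X [Y [P1 wE _ PsiE]]] := su3 0.
have [Q Qu [sE vE]] := adapt_coframe P1.
exists Q => //; apply: sp_lie_sl2C => // [x y|x].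
  rewrite -!sE; apply: closed_pfaff_lie.
  suff <- : w = linv B (pfaff_form X Y) by [].
  rewrite {1}(left_inv_linv wB); congr (linv B _).
  by apply/funext => v; rewrite [v in LHS]vpairE wE.
rewrite -[RHS](@closed_Re_cvol_lie _ B X Y x).
  apply: eq_bigr => i _.
  rewrite -(vE (fun j => if j == i then B *m x i else x j)).
  congr (complex.Re (cvol _ _ _)); apply/funext => j.
  by rewrite /upd; case: eqP.
suff <- : Re_form Psi = linv B (Re_cvol_form X Y) by [].
apply/funext => p; apply/funext => v.
rewrite /Re_form (left_inv_linv PsiB) /linv /Re_cvol_form; congr complex.Re.
exact: PsiE.
Qed.

(* K is multiplication of (z, w) by i, and minus the complex determinant is
   u + i v. *)
Lemma sl2C_square a1 a2 b1 b2 c1 c2 :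
  let N := sl2C_mx a1 a2 b1 b2 c1 c2 in
  exists K : 'M[R]_5, exists u v : R,
    [/\ K *m N = N *m K, K *m K *m N = - N & N *m N = - u *: (K *m K) + v *: K].
Proof.
move=> N.
pose K : 'M[R]_5 := mx5 [:: [:: 0; 1; 0; 0; 0]; [:: -1; 0; 0; 0; 0];
  [:: 0; 0; 0; 0; 0]; [:: 0; 0; 0; 0; -1]; [:: 0; 0; 0; 1; 0]].
exists K, (a1 ^+ 2 - a2 ^+ 2 + (b1 * c1 - b2 * c2)).
exists (2 * a1 * a2 + (b1 * c2 + b2 * c1)).
by rewrite /N /K /sl2C_mx !mulmx5 /=; split; entries5.
Qed.

End Necessity.

(** * Obstructions *)

Section Obstructions.
Variable R : realType.
Implicit Types (B Q : 'M[R]_5).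

(** Conjugation by [Q] carries the relations of [sl2C_square] to B. They mention neither the form
    nor the coframe, so they can be tested on B alone. *)
Lemma half_flat_square B w : closed_form w -> half_flat B w ->
  exists K : 'M[R]_5, exists u v : R,
    [/\ K *m B = B *m K, K *m K *m B = - B &
        B *m B = - u *: (K *m K) + v *: K].
Proof.
move=> cw /(half_flat_sl2C cw)[Q Qu [a1 [a2 [b1 [b2 [c1 [c2 QB]]]]]]].
set N := sl2C_mx a1 a2 b1 b2 c1 c2 in QB.
have [K [u [v [KN KKN NN]]]] := sl2C_square a1 a2 b1 b2 c1 c2.
have BE : B = invmx Q *m N *m Q by rewrite -mulmxA -QB mulKmx.
pose f M := invmx Q *m M *m Q.
have fM M M' : f M *m f M' = f (M *m M').
  by rewrite /f !mulmxA mulmxK.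
have BN : B = f N by [].
exists (f K), u, v; rewrite BN !fM KN KKN NN; split=> //.
  by rewrite /f mulmxN mulNmx.
by rewrite /f mulmxDr mulmxDl -!scalemxAr -!scalemxAl.
Qed.

(* On the image of B the square of B is the scalar u + i v. *)
Lemma square_on_image B K (u v : R) (x : 'cV[R]_5) :
  K *m B = B *m K -> K *m K *m B = - B ->
  B *m B = - u *: (K *m K) + v *: K ->
  B *m (B *m (B *m x)) = u *: (B *m x) + v *: (K *m (B *m x)).
Proof.
move=> KB KKB BB; rewrite mulmxA BB mulmxDl -!scalemxAl.
have -> : K *m K *m (B *m x) = - (B *m x) by rewrite mulmxA KKB mulNmx.
by rewrite scaleNr scalerN opprK.
Qed.

(** On the image of B, where K acts as i, the equation B^2 x = 0 reads (u + iv) x = 0. As x is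
    nonzero, u + iv vanishes, and B^2 with it. *)
Lemma half_flat_nilpotent B w (x y : 'cV[R]_5) :
  closed_form w -> half_flat B w ->
  B *m y = x -> B *m x = 0 -> x != 0 ->
  B *m B = 0 /\ exists2 K : 'M[R]_5, K *m B = B *m K & K *m K *m x = - x.
Proof.
move=> cw hf Byx Bx0 x0.
have [K [u [v [KB KKB BB]]]] := half_flat_square cw hf.
have KKx : K *m K *m x = - x by rewrite -Byx mulmxA KKB mulNmx.
have := square_on_image y KB KKB BB; rewrite Byx Bx0 mulmx0 => /esym E.
(* Multiplication by the conjugate u - vK. *)
have E' : (u ^+ 2 + v ^+ 2) *: x = 0.
  have := congr1 (fun z => u *: z - v *: (K *m z)) E.
  rewrite mulmx0 !scaler0 subr0 => <-.
  rewrite mulmxDr -!scalemxAr mulmxA KKx !scalerDr !scalerA scalerN.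
  by rewrite opprD opprK addrA scalerDl !expr2 (mulrC v u) addrK.
have {E'} : u ^+ 2 + v ^+ 2 == 0.
  by move/eqP: E'; rewrite scaler_eq0 (negPf x0) orbF.
rewrite paddr_eq0 ?sqr_ge0// !sqrf_eq0 => /andP[/eqP u0 /eqP v0].
split; first by rewrite BB u0 v0 oppr0 !scale0r addr0.
by exists K.
Qed.

(** On its image B satisfies (B^2 - u)^2 = - v^2. On a plane with eigenvalues l +- im, the two
    equations are the imaginary part (up to a factor) and the real part of ((l + im)^2 - u)^2 + v^2
    = 0. The pair u, v serves all planes at once. *)
Lemma half_flat_eigenvalue B w : closed_form w -> half_flat B w ->
  exists u v : R, forall (l m : R) (x y : 'cV[R]_5),
  (forall a b : R, a *: x + b *: y = 0 -> a = 0 /\ b = 0) ->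
  B *m x = l *: x - m *: y -> B *m y = m *: x + l *: y ->
  l ^+ 2 + m ^+ 2 != 0 ->
  (l ^+ 2 - m ^+ 2 - u) * (l * m) = 0 /\
  (l ^+ 2 - m ^+ 2 - u) ^+ 2 - (2 * l * m) ^+ 2 + v ^+ 2 = 0.
Proof.
move=> cw hf; have [K [u [v [KB KKB BB]]]] := half_flat_square cw hf.
exists u, v => l m x y ind Bx By lm0.
(* B is invertible on the plane, and [z] is the preimage of x: this puts x in the image of B. *)
pose z := (l ^+ 2 + m ^+ 2)^-1 *: (l *: x + m *: y).
have Bz : B *m z = x.
  rewrite /z -scalemxAr mulmxDr -!scalemxAr Bx By.
  apply/colP => i; rewrite !mxE; field.
  by [].
have E1 : B *m (B *m x) = u *: x + v *: (K *m x).
  by have := square_on_image z KB KKB BB; rewrite Bz.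
have KKx : K *m (K *m x) = - x by rewrite -Bz !mulmxA KKB mulNmx.
have E2 : B *m (B *m (K *m x)) = u *: (K *m x) - v *: x.
  have := square_on_image (K *m z) KB KKB BB.
  have -> : B *m (K *m z) = K *m x by rewrite mulmxA -KB -mulmxA Bz.
  by rewrite KKx scalerN.
have E3 : B *m (B *m (B *m (B *m x))) - (2 * u) *: (B *m (B *m x)) +
    (u ^+ 2 + v ^+ 2) *: x = 0.
  rewrite E1 2!mulmxDr -!scalemxAr E1 E2.
  by apply/colP => i; rewrite !mxE; ring.
have [] := ind ((l ^+ 2 - m ^+ 2 - u) ^+ 2 - (2 * l * m) ^+ 2 + v ^+ 2)
   (- (4 * (l ^+ 2 - m ^+ 2 - u) * (l * m))).
  rewrite -[RHS]E3.
  have BL a b : B *m (a *: x + b *: y) =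
      (a * l + b * m) *: x + (b * l - a * m) *: y.
    rewrite mulmxDr -!scalemxAr Bx By.
    by apply/colP => i; rewrite !mxE; ring.
  have Bx' : B *m x = l *: x + (- m) *: y by rewrite Bx scaleNr.
  rewrite Bx' !BL.
  by apply/colP => i; rewrite !mxE; ring.
move=> -> H; split=> //; move/eqP: H; rewrite oppr_eq0 -mulrA mulf_eq0.
by rewrite pnatr_eq0 /= => /eqP.
Qed.

End Obstructions.

(** * The groups *)

Section Examples.
Variable R : realType.
Implicit Types (B Bt S Q : 'M[R]_5).

Lemma mulmx_E i j k l : (0 < i <= 5)%N ->
  E R i j *m E R k l = (i == l)%:R *: E R k j.
Proof.
case: i => // i i5; apply/matrixP => a b; rewrite !mxE (bigD1 (inord i)) //=.
rewrite big1 => [|c /negbTE ci].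
  rewrite !mxE inordK // eqxx andbT addr0.
  by do 3 case: (_ == _) => //=; rewrite ?mulr0 ?mul0r ?mulr1.
rewrite !mxE eqSS (_ : (c == i :> nat) = false) ?andbF ?mul0r //.
by apply: contraFF ci => /eqP <-; rewrite inord_val.
Qed.

Lemma rot_cube i j (S := E R i j - E R j i) : i != j ->
  (0 < i <= 5)%N -> (0 < j <= 5)%N -> S *m S *m S = - S.
Proof.
move=> /negbTE ij i5 j5; have ji : (j == i) = false by rewrite eq_sym.
have -> : S *m S = - (E R i i + E R j j).
  rewrite /S !(mulmxBl, mulmxBr) !mulmx_E // !eqxx ij ji !(scale0r, scale1r).
  by rewrite subr0 sub0r opprD addrC.
rewrite /S mulNmx !(mulmxDl, mulmxBr) !mulmx_E // !eqxx ij ji.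
by rewrite !(scale0r, scale1r) subr0 sub0r addrC.
Qed.

Lemma cubeD n (A B : 'M[R]_n) : A *m A *m A = - A -> B *m B *m B = - B ->
  A *m B = 0 -> B *m A = 0 -> (A + B) *m (A + B) *m (A + B) = - (A + B).
Proof.
move=> A3 B3 AB BA; rewrite !(mulmxDl, mulmxDr) AB BA !mul0mx !(addr0, add0r).
by rewrite A3 B3 -!mulmxA AB BA !mulmx0 addr0 add0r opprD.
Qed.

Definition rot12 : 'M[R]_5 := E R 2 1 - E R 1 2.
Definition rot34 : 'M[R]_5 := E R 4 3 - E R 3 4.
Definition rot45 : 'M[R]_5 := E R 5 4 - E R 4 5.

Lemma rot12_cube : rot12 *m rot12 *m rot12 = - rot12.
Proof. exact: rot_cube. Qed.

Lemma rot34_cube : rot34 *m rot34 *m rot34 = - rot34.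
Proof. exact: rot_cube. Qed.

Lemma rot45_cube : rot45 *m rot45 *m rot45 = - rot45.
Proof. exact: rot_cube. Qed.

Lemma rot1234_cube (S := rot12 + rot34) : S *m S *m S = - S.
Proof.
apply: cubeD; rewrite ?rot12_cube ?rot34_cube //;
  by rewrite !(mulmxBl, mulmxBr) !mulmx_E //= !scale0r !subr0.
Qed.

Lemma B610_decomp : B610 R = Bt610 R + rot45.
Proof. by rewrite /B610 /Bt610 /rot45 -!addrA [- _ + _]addrC. Qed.

Lemma B514_decomp : B514 R = Bt514 R + rot34.
Proof. by rewrite /B514 /Bt514 /rot34 -!addrA [- _ + _]addrC. Qed.

Lemma B518_decomp : B518 R = Bt518 R + (rot12 + rot34).
Proof. rewrite /B518 /Bt518 /rot12 /rot34; entries5. Qed.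

Lemma B35_decomp : B35 R = Bt35 R + rot12.
Proof. by rewrite /B35 /Bt35 /rot12 add0r addrC. Qed.

Lemma B517_decomp p r : B517 p r = Bt517 p + (rot12 + r *: rot34).
Proof. rewrite /B517 /Bt517 /rot12 /rot34; entries5. Qed.

Lemma on_quotient_left_inv B tb L k T (al : field R k T) :
  left_inv B al -> on_quotient B tb L al.
Proof. by move=> H g _. Qed.

Lemma on_quotient_modified B Bt tb L k T (al : field R k T) :
  (forall n : int, expm ((n%:~R * tb) *: B) = expm ((n%:~R * tb) *: Bt)) ->
  left_inv Bt al -> on_quotient B tb L al.
Proof.
move=> H Bal g [n _ [x _ <-]]; apply: (pullback_linv_eq Bal).
by rewrite tm_mkpt.
Qed.

Lemma expm_add_rotation Bt S (n : int) :
  Bt *m S = S *m Bt -> S *m S *m S = - S ->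
  expm ((n%:~R * (2 * pi)) *: (Bt + S)) = expm ((n%:~R * (2 * pi)) *: Bt).
Proof.
move=> BS S3; rewrite expm_add_comm// [in X in _ *m X]mulrC.
by rewrite expm_rotation_2pi// mulmx1.
Qed.

(** A field left-invariant for both groups is the transport of the same tensor at the identity for
    either one, so its closedness would make B annihilate [sig]. *)
Lemma not_left_inv_std_form B Bt Q (x y : 'cV[R]_5) :
  closed_form (std_form Bt Q) -> sig Q (B *m x) y + sig Q x (B *m y) != 0 ->
  ~ left_inv B (std_form Bt Q).
Proof.
move=> cw /eqP H wB; apply: H.
have := @closed_pfaff_lie _ B (adaptedX Q) (adaptedY Q) x y.
rewrite !pfaff_adapted !tm_mkpt !sp_mkpt !mul0r !mulr0 subr0 !add0r; apply.
suff <- : std_form Bt Q = linv B (pfaff_form (adaptedX Q) (adaptedY Q)) by [].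
rewrite {1}(left_inv_linv wB); congr (linv B _); apply/funext => v.
by rewrite std_formE tm0 oppr0 dltrans0 !mul1mx.
Qed.

Lemma invariant_std_form B Q tb L : Q \in unitmx ->
  (forall x y, sig Q (B *m x) y + sig Q x (B *m y) = 0) ->
  invariant_symplectic B tb L (std_form B Q).
Proof.
move=> Qu H; split; first exact: std_form_symplectic.
  exact/on_quotient_left_inv/std_form_left_inv.
exact: std_form_left_inv.
Qed.

Lemma not_invariant_std_form B Bt Q tb L (x y : 'cV[R]_5) : Q \in unitmx ->
  (forall n : int, expm ((n%:~R * tb) *: B) = expm ((n%:~R * tb) *: Bt)) ->
  (forall x y, sig Q (Bt *m x) y + sig Q x (Bt *m y) = 0) ->
  sig Q (B *m x) y + sig Q x (B *m y) != 0 ->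
  not_invariant_symplectic B Bt tb L (std_form Bt Q).
Proof.
move=> Qu HB HBt Hxy; split; first exact: std_form_symplectic.
- exact/on_quotient_modified/std_form_left_inv.
- exact: std_form_left_inv.
- by apply: not_left_inv_std_form Hxy; exact: closed_linv_pfaff.
Qed.

(* The 2-forms a/\c + b/\d given by these coframes are, in terms of the basis
   x1, ..., x5 dual to the X_i:
     Q610 t : (x2 - t x4)/\x3 + x4/\x5     Q514 t : (x1 - t x3)/\x2 + x3/\x4
     Q517 s : x1/\x3 + s x2/\x4            Q518 : x4/\x1 + x3/\x2. *)
Definition Q610 (t : R) := mx5 [:: [:: 0; 1; 0; - t; 0]; [:: 0; 0; 0; 1; 0];
  [:: 1; 0; 0; 0; 0]; [:: 0; 0; 1; 0; 0]; [:: 0; 0; 0; 0; 1]].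

Definition Q514 (t : R) := mx5 [:: [:: 1; 0; - t; 0; 0]; [:: 0; 0; 1; 0; 0];
  [:: 0; 0; 0; 0; 1]; [:: 0; 1; 0; 0; 0]; [:: 0; 0; 0; 1; 0]].

Definition Q517 (s : R) := mx5 [:: [:: 1; 0; 0; 0; 0]; [:: 0; 1; 0; 0; 0];
  [:: 0; 0; 0; 0; 1]; [:: 0; 0; 1; 0; 0]; [:: 0; 0; 0; s; 0]].

Definition Q518 : 'M[R]_5 := mx5 [:: [:: 0; 0; 0; 1; 0]; [:: 0; 0; 1; 0; 0];
  [:: 0; 0; 0; 0; 1]; [:: 1; 0; 0; 0; 0]; [:: 0; 1; 0; 0; 0]].

Lemma Q610_unit t : Q610 t \in unitmx.
Proof.
have /mulmx1_unit [//] : Q610 t *m mx5 [:: [:: 0; 0; 1; 0; 0];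
  [:: 1; t; 0; 0; 0]; [:: 0; 0; 0; 1; 0]; [:: 0; 1; 0; 0; 0];
  [:: 0; 0; 0; 0; 1]] = 1%:M.
rewrite mulmx5 /=; entries5.
Qed.

Lemma Q514_unit t : Q514 t \in unitmx.
Proof.
have /mulmx1_unit [//] : Q514 t *m mx5 [:: [:: 1; t; 0; 0; 0];
  [:: 0; 0; 0; 1; 0]; [:: 0; 1; 0; 0; 0]; [:: 0; 0; 0; 0; 1];
  [:: 0; 0; 1; 0; 0]] = 1%:M.
rewrite mulmx5 /=; entries5.
Qed.

Lemma Q518_unit : Q518 \in unitmx.
Proof.
have /mulmx1_unit [//] : Q518 *m mx5 [:: [:: 0; 0; 0; 1; 0];
  [:: 0; 0; 0; 0; 1]; [:: 0; 1; 0; 0; 0]; [:: 1; 0; 0; 0; 0];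
  [:: 0; 0; 1; 0; 0]] = 1%:M.
rewrite mulmx5 /=; entries5.
Qed.

Lemma Q517_unit s : s != 0 -> Q517 s \in unitmx.
Proof.
move=> s0.
have /mulmx1_unit [//] : Q517 s *m mx5 [:: [:: 1; 0; 0; 0; 0];
  [:: 0; 1; 0; 0; 0]; [:: 0; 0; 0; 1; 0]; [:: 0; 0; 0; 0; s^-1];
  [:: 0; 0; 1; 0; 0]] = 1%:M.
apply/matrixP => i j; rewrite !(mxE, sum5) ?inordK //;
  case: i => [[|[|[|[|[|//]]]]] ?]; case: j => [[|[|[|[|[|//]]]]] ?];
  by rewrite /= ?(mul0r, mulr0, mul1r, mulr1, addr0, add0r) ?mulfV.
Qed.

End Examples.

(** * Action of the derivations on the chosen 2-forms *)

Section Computations.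
Variable R : realType.

Local Notation x_ x k := (x (inord k) ord0).

Lemma mul_mx5 (r : seq (seq R)) (x : 'cV[R]_5) i : (i < 5)%N ->
  (mx5 r *m x) (inord i) ord0 =
  (nth [::] r i)`_0 * x_ x 0 + (nth [::] r i)`_1 * x_ x 1 +
  (nth [::] r i)`_2 * x_ x 2 + (nth [::] r i)`_3 * x_ x 3 +
  (nth [::] r i)`_4 * x_ x 4.
Proof. by move=> i5; rewrite mxE sum5 /mx5 !mxE !inordK. Qed.

Lemma sig_mx5 (q b : seq (seq R)) (x y : 'cV[R]_5) :
  let dot r (f : nat -> R) :=
    r`_0 * f 0%N + r`_1 * f 1%N + r`_2 * f 2%N + r`_3 * f 3%N + r`_4 * f 4%N in
  let row i := nth [::] q i in
  let mul (v : 'cV[R]_5) i := dot (nth [::] b i) (fun k => x_ v k) in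
  sig (mx5 q) (mx5 b *m x) y + sig (mx5 q) x (mx5 b *m y) =
  dot (row 0%N) (mul x) * dot (row 3%N) (fun k => x_ y k)
  - dot (row 3%N) (mul x) * dot (row 0%N) (fun k => x_ y k) +
  (dot (row 1%N) (mul x) * dot (row 4%N) (fun k => x_ y k)
  - dot (row 4%N) (mul x) * dot (row 1%N) (fun k => x_ y k)) +
  (dot (row 0%N) (fun k => x_ x k) * dot (row 3%N) (mul y)
  - dot (row 3%N) (fun k => x_ x k) * dot (row 0%N) (mul y) +
  (dot (row 1%N) (fun k => x_ x k) * dot (row 4%N) (mul y)
  - dot (row 4%N) (fun k => x_ x k) * dot (row 1%N) (mul y))).
Proof. by move=> dot row mul; rewrite /sig /coord !mul_mx5. Qed.

Lemma B610E : B610 R = mx5 [:: [:: 0; 1; 0; 0; 0]; [:: 0; 0; 1; 0; 0];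
  [:: 0; 0; 0; 0; 0]; [:: 0; 0; 0; 0; 1]; [:: 0; 0; 0; -1; 0]].
Proof. rewrite /B610; entries5. Qed.

Lemma Bt610E : Bt610 R = mx5 [:: [:: 0; 1; 0; 0; 0]; [:: 0; 0; 1; 0; 0];
  [:: 0; 0; 0; 0; 0]; [:: 0; 0; 0; 0; 0]; [:: 0; 0; 0; 0; 0]].
Proof. rewrite /Bt610; entries5. Qed.

Lemma B514E : B514 R = mx5 [:: [:: 0; 1; 0; 0; 0]; [:: 0; 0; 0; 0; 0];
  [:: 0; 0; 0; 1; 0]; [:: 0; 0; -1; 0; 0]; [:: 0; 0; 0; 0; 0]].
Proof. rewrite /B514; entries5. Qed.

Lemma Bt514E : Bt514 R = mx5 [:: [:: 0; 1; 0; 0; 0]; [:: 0; 0; 0; 0; 0];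
  [:: 0; 0; 0; 0; 0]; [:: 0; 0; 0; 0; 0]; [:: 0; 0; 0; 0; 0]].
Proof. rewrite /Bt514; entries5. Qed.

Lemma B517E p r : B517 p r = mx5 [:: [:: p; 1; 0; 0; 0]; [:: -1; p; 0; 0; 0];
  [:: 0; 0; - p; r; 0]; [:: 0; 0; - r; - p; 0]; [:: 0; 0; 0; 0; 0]] :> 'M[R]_5.
Proof. rewrite /B517; entries5. Qed.

Lemma Bt517E p : Bt517 p = mx5 [:: [:: p; 0; 0; 0; 0]; [:: 0; p; 0; 0; 0];
  [:: 0; 0; - p; 0; 0]; [:: 0; 0; 0; - p; 0]; [:: 0; 0; 0; 0; 0]] :> 'M[R]_5.
Proof. rewrite /Bt517; entries5. Qed.

Lemma B518E : B518 R = mx5 [:: [:: 0; 1; 1; 0; 0]; [:: -1; 0; 0; 1; 0];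
  [:: 0; 0; 0; 1; 0]; [:: 0; 0; -1; 0; 0]; [:: 0; 0; 0; 0; 0]].
Proof. rewrite /B518; entries5. Qed.

Lemma Bt518E : Bt518 R = mx5 [:: [:: 0; 0; 1; 0; 0]; [:: 0; 0; 0; 1; 0];
  [:: 0; 0; 0; 0; 0]; [:: 0; 0; 0; 0; 0]; [:: 0; 0; 0; 0; 0]].
Proof. rewrite /Bt518; entries5. Qed.

Lemma B35E : B35 R = mx5 [:: [:: 0; 1; 0; 0; 0]; [:: -1; 0; 0; 0; 0];
  [:: 0; 0; 0; 0; 0]; [:: 0; 0; 0; 0; 0]; [:: 0; 0; 0; 0; 0]].
Proof. rewrite /B35; entries5. Qed.

Ltac coords5 :=
  rewrite ?B610E ?Bt610E ?B514E ?Bt514E ?B517E ?Bt517E ?B518E ?Bt518E ?B35E;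
  rewrite /Q610 /Q514 /Q517 /Q518 sig_mx5 /=; ring.

(** The defect is proportional to t: t = 0 gives an invariant form, t = 1 one that is invariant for
    the modified group only. *)
Lemma sig_B610 t (x y : 'cV[R]_5) :
  sig (Q610 t) (B610 R *m x) y + sig (Q610 t) x (B610 R *m y) =
  t * (x_ x 2 * x_ y 4 - x_ x 4 * x_ y 2).
Proof. coords5. Qed.

Lemma sig_Bt610 t (x y : 'cV[R]_5) :
  sig (Q610 t) (Bt610 R *m x) y + sig (Q610 t) x (Bt610 R *m y) = 0.
Proof. coords5. Qed.

Lemma sig_B514 t (x y : 'cV[R]_5) :
  sig (Q514 t) (B514 R *m x) y + sig (Q514 t) x (B514 R *m y) =
  t * (x_ x 1 * x_ y 3 - x_ x 3 * x_ y 1).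
Proof. coords5. Qed.

Lemma sig_Bt514 t (x y : 'cV[R]_5) :
  sig (Q514 t) (Bt514 R *m x) y + sig (Q514 t) x (Bt514 R *m y) = 0.
Proof. coords5. Qed.

(** For p = 0 both planes merely rotate, so the sum of their area forms is preserved whatever r
    is. *)
Lemma sig_B517_0 r (x y : 'cV[R]_5) :
  sig (Q514 0) (B517 0 r *m x) y + sig (Q514 0) x (B517 0 r *m y) = 0.
Proof. coords5. Qed.

(** Both coefficients vanish for s = r when r^2 = 1, while for s = 2 they never vanish together. *)
Lemma sig_B517 p r s (x y : 'cV[R]_5) :
  sig (Q517 s) (B517 p r *m x) y + sig (Q517 s) x (B517 p r *m y) =
  (1 - s * r) * (x_ x 1 * x_ y 2 - x_ x 2 * x_ y 1) +
  (r - s) * (x_ x 0 * x_ y 3 - x_ x 3 * x_ y 0).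
Proof. coords5. Qed.

Lemma sig_B35 (x y : 'cV[R]_5) :
  sig (Q517 1) (B35 R *m x) y + sig (Q517 1) x (B35 R *m y) =
  (x_ x 1 * x_ y 2 - x_ x 2 * x_ y 1) - (x_ x 0 * x_ y 3 - x_ x 3 * x_ y 0).
Proof. coords5. Qed.

Lemma sig_B518 (x y : 'cV[R]_5) :
  sig (Q518 R) (B518 R *m x) y + sig (Q518 R) x (B518 R *m y) =
  2 * (x_ x 0 * x_ y 2 - x_ x 2 * x_ y 0 + x_ x 3 * x_ y 1 - x_ x 1 * x_ y 3).
Proof. coords5. Qed.

(** In z = x1 - i x2, w = x3 + i x4 the action is diagonal with entries p + i and -(p + i), which
    cancel because r = 1. *)
Lemma sl2C_B517 (p : R) : Q517 1 *m B517 p 1 = sl2C_mx p 1 0 0 0 0 *m Q517 1.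
Proof. rewrite B517E /Q517 /sl2C_mx !mulmx5 /=; entries5. Qed.

(** The modified derivation is the scalar p on one plane and -p on the other, so rescaling x4 by s
    is harmless. *)
Lemma sl2C_Bt517 (p s : R) : Q517 s *m Bt517 p = sl2C_mx p 0 0 0 0 0 *m Q517 s.
Proof. rewrite Bt517E /Q517 /sl2C_mx !mulmx5 /=; entries5. Qed.

(** With z = x4 - i x3 and w = x1 + i x2 this is the nilpotent map (z, w) |-> (0, i z). *)
Lemma sl2C_Bt518 : Q518 R *m Bt518 R = sl2C_mx 0 0 0 0 0 1 *m Q518 R.
Proof. rewrite Bt518E /Q518 /sl2C_mx !mulmx5 /=; entries5. Qed.

Lemma sl2C_Bt35 : Q517 1 *m Bt35 R = sl2C_mx 0 0 0 0 0 0 *m Q517 1.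
Proof. entries5. Qed.

Definition ev (k : nat) : 'cV[R]_5 := \col_i (val i == k)%:R.

Lemma evE k l : (l < 5)%N -> ev k (inord l) ord0 = (l == k)%:R.
Proof. by move=> l5; rewrite mxE /= inordK. Qed.

Lemma ev_neq0 k : (k < 5)%N -> ev k != 0.
Proof.
move=> k5; apply/eqP => /colP /(_ (inord k)); rewrite evE// eqxx mxE => /eqP.
by rewrite oner_eq0.
Qed.

Lemma lie_isomorphic_adapted (B B' Q : 'M[R]_5) : Q \in unitmx ->
  Q *m B = B' *m Q -> lie_isomorphic B B'.
Proof.
move=> Qu QB; exists (block_mx 1%:M 0 0 Q).
  by rewrite unitmxE (det_lblock (1%:M : 'M[R]_1)) det1 mul1r -unitmxE.
move=> u v; rewrite /bracket !mul_block_mkpt !mul1r !tm_mkpt !sp_mkpt.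
by rewrite mulmxBr -!scalemxAr !mulmxA QB.
Qed.

(** If p is nonzero, the imaginary parts give p^2 - 1 = u = p^2 - r^2. If p = 0, the real parts are
    sums of two squares and give -1 = u = -r^2. *)
Lemma half_flat_eigenvalues_r (p r u v : R) : r != 0 ->
  (p ^+ 2 - 1 ^+ 2 - u) * (p * 1) = 0 ->
  (p ^+ 2 - 1 ^+ 2 - u) ^+ 2 - (2 * p * 1) ^+ 2 + v ^+ 2 = 0 ->
  ((- p) ^+ 2 - r ^+ 2 - u) * (- p * r) = 0 ->
  ((- p) ^+ 2 - r ^+ 2 - u) ^+ 2 - (2 * (- p) * r) ^+ 2 + v ^+ 2 = 0 ->
  r ^+ 2 = 1.
Proof.
move=> r0; have [->|p0] := eqVneq p 0; last first.
  move=> /eqP; rewrite mulr1 mulf_eq0 (negPf p0) orbF => /eqP E1 _.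
  move=> /eqP; rewrite mulf_eq0 mulf_eq0 oppr_eq0 (negPf p0) (negPf r0) !orbF.
  by move=> /eqP E2 _; lra.
move=> _ E1 _ E2.
have H (a : R) : a ^+ 2 + v ^+ 2 = 0 -> a = 0.
  by move=> /eqP; rewrite paddr_eq0 ?sqr_ge0// sqrf_eq0 => /andP[/eqP].
have h1 : 0 ^+ 2 - 1 ^+ 2 - u = 0 by apply: H; rewrite -[RHS]E1; ring.
have h2 : (- 0) ^+ 2 - r ^+ 2 - u = 0 by apply: H; rewrite -[RHS]E2; ring.
lra.
Qed.

End Computations.

(** * Obstructions, normal form and periods for the individual groups *)

Section Conclusion.
Variable R : realType.

Lemma mx5_ev (r : seq (seq R)) k i : (i < 5)%N -> (k < 5)%N ->
  (mx5 r *m ev R k) (inord i) ord0 = (nth [::] r i)`_k.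
Proof.
move=> i5; rewrite mul_mx5 // !evE //.
by case: k => [|[|[|[|[|//]]]]] _ /=; ring.
Qed.

Lemma colP5 (x y : 'cV[R]_5) :
  (forall i, (i < 5)%N -> x (inord i) ord0 = y (inord i) ord0) -> x = y.
Proof. by move=> H; apply/colP => i; rewrite -(inord_val i); exact: H. Qed.

Ltac vec5 := apply: colP5 => -[|[|[|[|[|//]]]]] _;
  rewrite ?mx5_ev // ?mxE ?evE //= ?inordK //=; ring.

(** A Jordan block on X_1, X_2 would force B^2 = 0; a nonzero entry of B^2, from a rotation plane or
    a longer Jordan chain, refutes this. *)
Lemma not_half_flat_square (B : 'M[R]_5) w i k : closed_form w ->
  B *m ev R 1 = ev R 0 -> B *m ev R 0 = 0 -> (i < 5)%N ->
  (B *m (B *m ev R k)) (inord i) ord0 != 0 -> ~ half_flat B w.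
Proof.
move=> cw B1 B0 i5 /eqP Bk hf; apply: Bk.
have [BB _] := half_flat_nilpotent cw hf B1 B0 (ev_neq0 R (isT : (0 < 5)%N)).
by rewrite mulmxA BB mul0mx mxE.
Qed.

Lemma not_half_flat_610 w : closed_form w -> ~ half_flat (B610 R) w.
Proof.
move=> cw; rewrite B610E.
apply: (@not_half_flat_square _ _ 4 4) => //; try vec5.
rewrite (_ : mx5 _ *m ev R 4 = ev R 3); last by vec5.
by rewrite mx5_ev//= oppr_eq0 oner_eq0.
Qed.

Lemma not_half_flat_Bt610 w : closed_form w -> ~ half_flat (Bt610 R) w.
Proof.
move=> cw; rewrite Bt610E.
apply: (@not_half_flat_square _ _ 0 2) => //; try vec5.
rewrite (_ : mx5 _ *m ev R 2 = ev R 1); last by vec5.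
by rewrite mx5_ev//= oner_eq0.
Qed.

Lemma not_half_flat_514 w : closed_form w -> ~ half_flat (B514 R) w.
Proof.
move=> cw; rewrite B514E.
apply: (@not_half_flat_square _ _ 3 3) => //; try vec5.
rewrite (_ : mx5 _ *m ev R 3 = ev R 2); last by vec5.
by rewrite mx5_ev//= oppr_eq0 oner_eq0.
Qed.

(* Here B has rank one, while the commuting complex structure makes the image
   of B even-dimensional. *)
Lemma not_half_flat_Bt514 w : closed_form w -> ~ half_flat (Bt514 R) w.
Proof.
move=> cw hf.
have B1 : Bt514 R *m ev R 1 = ev R 0 by rewrite Bt514E; vec5.
have B0 : Bt514 R *m ev R 0 = 0 by rewrite Bt514E; vec5.
have [_ [K KB KKx]] :=
  half_flat_nilpotent cw hf B1 B0 (ev_neq0 R (isT : (0 < 5)%N)).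
have Bx (x : 'cV[R]_5) : Bt514 R *m x = x (inord 1) ord0 *: ev R 0.
  by rewrite Bt514E; apply: colP5 => -[|[|[|[|[|//]]]]] _;
    rewrite mul_mx5// mxE evE //=; ring.
have Kx : K *m ev R 0 = (K *m ev R 1) (inord 1) ord0 *: ev R 0.
  by rewrite -{1}B1 mulmxA KB -mulmxA Bx.
have := congr1 (fun x : 'cV[R]_5 => x (inord 0) ord0) KKx.
move: ((K *m ev R 1) (inord 1) ord0) Kx => k Kx.
rewrite -mulmxA Kx -scalemxAr Kx scalerA => /eqP.
rewrite !mxE /= inordK//= mulr1 -subr_eq0 opprK gt_eqF//.
by rewrite ltr_wpDl// -expr2 sqr_ge0.
Qed.

Lemma ev_free k l (a b : R) : (k < 5)%N -> (l < 5)%N -> k != l ->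
  a *: ev R k + b *: ev R l = 0 -> a = 0 /\ b = 0.
Proof.
move=> k5 l5 kl /colP E; have := E (inord k); have := E (inord l).
rewrite !mxE /= !inordK// !eqxx [l == k]eq_sym (negPf kl).
by rewrite !mulr0 !mulr1 addr0 add0r => -> ->.
Qed.

(** The planes X_1, X_2 and X_3, X_4 have eigenvalues p +- i and -p +- ir, and share the same u,
    v. *)
Lemma half_flat_517_r (p r : R) w : r != 0 -> closed_form w ->
  half_flat (B517 p r) w -> r ^+ 2 = 1.
Proof.
move=> r0 cw /(half_flat_eigenvalue cw)[u [v H]].
have [||||H1 H2] := H p 1 (ev R 0) (ev R 1).
- by move=> a b; exact: ev_free.
- rewrite B517E; vec5.
- rewrite B517E; vec5.
- by rewrite gt_eqF// ltr_wpDl ?sqr_ge0// expr1n.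
have [||||H3 H4] := H (- p) r (ev R 2) (ev R 3).
- by move=> a b; exact: ev_free.
- rewrite B517E; vec5.
- rewrite B517E; vec5.
- by rewrite gt_eqF// ltr_wpDl ?sqr_ge0// exprn_even_gt0.
exact: half_flat_eigenvalues_r r0 H1 H2 H3 H4.
Qed.

(** [D (- 1)] reverses X_4 and so changes the sign of r; [P] exchanges the two planes and so changes
    the sign of p. *)
Lemma B517_normal_form (p r : R) : r ^+ 2 = 1 ->
  lie_isomorphic (B517 p r) (B517 `|p| 1).
Proof.
pose D (s : R) := mx5 [:: [:: 1; 0; 0; 0; 0]; [:: 0; 1; 0; 0; 0];
  [:: 0; 0; 1; 0; 0]; [:: 0; 0; 0; s; 0]; [:: 0; 0; 0; 0; 1]].
pose P : 'M[R]_5 := mx5 [:: [:: 0; 0; 1; 0; 0]; [:: 0; 0; 0; 1; 0];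
  [:: 1; 0; 0; 0; 0]; [:: 0; 1; 0; 0; 0]; [:: 0; 0; 0; 0; 1]].
have P1 : P \in unitmx.
  by have /mulmx1_unit[//] : P *m P = 1%:M; rewrite mulmx5 /=; entries5.
have D1 s : s = 1 \/ s = - 1 -> D s \in unitmx.
  move=> s1; have /mulmx1_unit[//] : D s *m D s = 1%:M.
  by case: s1 => ->; rewrite mulmx5 /=; entries5.
have DB q s : s = 1 \/ s = - 1 -> D s *m B517 q s = B517 q 1 *m D s.
  by case=> ->; rewrite !B517E !mulmx5 /=; entries5.
have PB q : P *m B517 q 1 = B517 (- q) 1 *m P.
  by rewrite !B517E !mulmx5 /=; entries5.
move=> r1; have {}r1 : r = 1 \/ r = - 1.
  by move/eqP: r1; rewrite sqrf_eq1 => /orP[]/eqP ->; [left | right].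
have [p0|p0] := ger0P p.
  exact: lie_isomorphic_adapted (D1 _ r1) (DB p r r1).
apply: (@lie_isomorphic_adapted _ _ _ (P *m D r)).
  by rewrite unitmx_mul P1 D1.
by rewrite -mulmxA DB// mulmxA PB mulmxA.
Qed.

(** The two planes turn at speeds 1 and r = r1 / r2. The factor r2 in the period makes both angles
    integer multiples of 2 pi. *)
Lemma expm_517 (p r : R) (r1 r2 n : int) : 0 < r2 -> r = r1%:~R / r2%:~R ->
  expm ((n%:~R * (2 * pi * r2%:~R)) *: B517 p r) =
  expm ((n%:~R * (2 * pi * r2%:~R)) *: Bt517 p).
Proof.
move=> r20 rE; rewrite B517_decomp.
have r2n0 : r2%:~R != 0 :> R by rewrite intr_eq0 gt_eqF.
rewrite expm_add_comm; last by rewrite Bt517E /rot12 /rot34; entries5.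
rewrite expm_add_comm; last by rewrite /rot12 /rot34; entries5.
have -> : n%:~R * (2 * pi * r2%:~R) = 2 * pi * (n * r2)%:~R :> R.
  by rewrite intrM; ring.
rewrite (expm_rotation_2pi (n * r2) (@rot12_cube R)).
have -> : (2 * pi * (n * r2)%:~R) *: (r *: rot34 R) =
    (2 * pi * (n * r1)%:~R) *: rot34 R.
  by rewrite scalerA rE !intrM; congr (_ *: _); field.
by rewrite (expm_rotation_2pi _ (@rot34_cube R)) !mulmx1.
Qed.

Lemma expm_610 (n : int) :
  expm ((n%:~R * (2 * pi)) *: B610 R) = expm ((n%:~R * (2 * pi)) *: Bt610 R).
Proof.
rewrite B610_decomp expm_add_rotation//; last exact: rot45_cube.
by rewrite Bt610E /rot45; entries5.
Qed.

Lemma expm_514 (n : int) :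
  expm ((n%:~R * (2 * pi)) *: B514 R) = expm ((n%:~R * (2 * pi)) *: Bt514 R).
Proof.
rewrite B514_decomp expm_add_rotation//; last exact: rot34_cube.
by rewrite Bt514E /rot34; entries5.
Qed.

Lemma expm_518 (n : int) :
  expm ((n%:~R * (2 * pi)) *: B518 R) = expm ((n%:~R * (2 * pi)) *: Bt518 R).
Proof.
rewrite B518_decomp expm_add_rotation//; last exact: rot1234_cube.
by rewrite Bt518E /rot12 /rot34; entries5.
Qed.

Lemma expm_35 (n : int) :
  expm ((n%:~R * (2 * pi)) *: B35 R) = expm ((n%:~R * (2 * pi)) *: Bt35 R).
Proof.
rewrite B35_decomp expm_add_rotation//; last exact: rot12_cube.
by rewrite /Bt35 mul0mx mulmx0.
Qed.

End Conclusion.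

Theorem proposition1p2 (R : realType) :
  (* (1) *)
  (forall B Bt : 'M[R]_5,
     (B = B610 R /\ Bt = Bt610 R) \/ (B = B514 R /\ Bt = Bt514 R) ->
   forall L, lattice_for B (2 * pi) L ->
     ((exists w, invariant_symplectic B (2 * pi) L w) /\
      (forall w, invariant_symplectic B (2 * pi) L w -> ~ half_flat B w)) /\
     ((exists w, not_invariant_symplectic B Bt (2 * pi) L w) /\
      (forall w, not_invariant_symplectic B Bt (2 * pi) L w ->
                 ~ half_flat Bt w))) /\
  (* (2) *)
  (forall (p r : R) (r1 r2 : int), 0 < r2 -> r1 != 0 -> r = r1%:~R / r2%:~R ->
   forall L, lattice_for (B517 p r) (2 * pi * r2%:~R) L ->
     [/\ (* invariant symplectic forms exist *)
         p = 0 \/ `|r| = 1 ->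
         exists w, invariant_symplectic (B517 p r) (2 * pi * r2%:~R) L w,
         (* half-flat ones exist for p >= 0 and r = 1, *)
         0 <= p -> r = 1 ->
         exists2 w, invariant_symplectic (B517 p r) (2 * pi * r2%:~R) L w
                  & half_flat (B517 p r) w,
         (* and only then, up to isomorphism *)
         (exists2 w, invariant_symplectic (B517 p r) (2 * pi * r2%:~R) L w
                   & half_flat (B517 p r) w) ->
         exists p' r' : R, [/\ 0 <= p', r' = 1
                             & lie_isomorphic (B517 p r) (B517 p' r')]
       & exists2 w, not_invariant_symplectic (B517 p r) (Bt517 p)
                                             (2 * pi * r2%:~R) L w
                  & half_flat (Bt517 p) w]) /\
  (* (3) *)
  (forall B Bt : 'M[R]_5,
     (B = B518 R /\ Bt = Bt518 R) \/ (B = B35 R /\ Bt = Bt35 R) ->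
   forall L, lattice_for B (2 * pi) L ->
     exists2 w, not_invariant_symplectic B Bt (2 * pi) L w
              & half_flat Bt w).
Proof.
split; [|split].
- move=> B Bt H L _.
  (* Both groups are treated at once: [Q0] carries a form annihilated by B, [Q1] one annihilated by
     Bt but not by B. *)
  have [Q0 [Q1 [[Q0u sig0] [Q1u sig1] [x [y xy]] [E nB nBt]]]] :
    exists Q0 Q1 : 'M[R]_5, [/\
      Q0 \in unitmx /\
        (forall x y, sig Q0 (B *m x) y + sig Q0 x (B *m y) = 0),
      Q1 \in unitmx /\
        (forall x y, sig Q1 (Bt *m x) y + sig Q1 x (Bt *m y) = 0),
      (exists x y, sig Q1 (B *m x) y + sig Q1 x (B *m y) != 0) &
      [/\ forall n : int,
        expm ((n%:~R * (2 * pi)) *: B) = expm ((n%:~R * (2 * pi)) *: Bt),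
        forall w, closed_form w -> ~ half_flat B w &
        forall w, closed_form w -> ~ half_flat Bt w]].
    case: H => -[-> ->].
      exists (Q610 0), (Q610 1); split.
      + by split=> [|x y]; [exact: Q610_unit | rewrite sig_B610 mul0r].
      + by split; [exact: Q610_unit | exact: sig_Bt610].
      + exists (ev R 2), (ev R 4); rewrite sig_B610 !evE//=.
      + split; [exact: expm_610 | exact: not_half_flat_610 |].
        exact: not_half_flat_Bt610.
    exists (Q514 0), (Q514 1); split.
    + by split=> [|x y]; [exact: Q514_unit | rewrite sig_B514 mul0r].
    + by split; [exact: Q514_unit | exact: sig_Bt514].
    + exists (ev R 1), (ev R 3); rewrite sig_B514 !evE//=.
    + split; [exact: expm_514 | exact: not_half_flat_514 |].
      exact: not_half_flat_Bt514.
  split; split.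
  + by exists (std_form B Q0); exact: invariant_std_form.
  + by move=> w [[_ cw _] _ _]; exact: nB.
  + by exists (std_form Bt Q1); exact: not_invariant_std_form xy.
  + by move=> w [[_ cw _] _ _ _]; exact: nBt.
- move=> p r r1 r2 r20 r10 rE L _.
  have r0 : r != 0.
    by rewrite rE mulf_neq0 ?invr_eq0 ?intr_eq0// gt_eqF.
  have Q1 : Q517 (1 : R) \in unitmx by apply: Q517_unit; exact: oner_neq0.
  split.
  (* For p = 0 the area forms of the two rotation planes serve; otherwise s = r does, as r^2 = 1. *)
  + have [-> _|p0] := eqVneq p 0.
      eexists; apply: (invariant_std_form _ _ (Q514_unit 0)).
      exact: sig_B517_0.
    case=> [pE|r1']; first by rewrite pE eqxx in p0.
    have rr : r * r = 1.
      by rewrite -expr2 -real_normK ?num_real// r1' expr1n.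
    eexists; apply: (invariant_std_form _ _ (Q517_unit r0)) => x y.
    by rewrite sig_B517 rr subrr mul0r add0r subrr mul0r.
  + move=> _ ->; exists (std_form (B517 p 1) (Q517 1)).
      apply: invariant_std_form => // x y.
      by rewrite sig_B517 mulr1 subrr !mul0r addr0.
    exact: half_flat_std_form Q1 (sl2C_B517 p).
  + move=> [w [[_ cw _] _ _] hf]; exists `|p|, 1; split=> //.
    exact/B517_normal_form/(half_flat_517_r r0 cw hf).
  (* s = 2 works for every r: the coefficients 1 - 2r and r - 2 have no common zero. The case r = 2
     is detected by the first, all others by the second. *)
  + have Q2 : Q517 (2 : R) \in unitmx by apply: Q517_unit; rewrite pnatr_eq0.
    exists (std_form (Bt517 p) (Q517 2)); last first.
      exact: half_flat_std_form Q2 (sl2C_Bt517 p 2).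
    have E n := expm_517 p n r20 rE.
    have S x y := sl2C_sig x y (sl2C_Bt517 p 2).
    have [r2E|r2N] := eqVneq r 2.
      apply: (not_invariant_std_form L (x := ev R 1) (y := ev R 2)) => //.
      rewrite sig_B517 !evE//= r2E [X in X != 0](_ : _ = - 3).
        by rewrite oppr_eq0 pnatr_eq0.
      ring.
    apply: (not_invariant_std_form L (x := ev R 0) (y := ev R 3)) => //.
    rewrite sig_B517 !evE//= [X in X != 0](_ : _ = r - 2) ?subr_eq0//; ring.
- move=> B Bt H L _; case: H => -[-> ->].
    exists (std_form (Bt518 R) (Q518 R)); last first.
      exact: half_flat_std_form (Q518_unit R) (@sl2C_Bt518 R).
    apply: (not_invariant_std_form L (x := ev R 0) (y := ev R 2)).
    + exact: Q518_unit.
    + exact: expm_518.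
    + by move=> x y; exact: sl2C_sig (@sl2C_Bt518 R).
    + rewrite sig_B518 !evE//= [X in X != 0](_ : _ = 2) ?pnatr_eq0//; ring.
  have Q1 : Q517 (1 : R) \in unitmx by apply: Q517_unit; exact: oner_neq0.
  exists (std_form (Bt35 R) (Q517 1)); last first.
    exact: half_flat_std_form Q1 (@sl2C_Bt35 R).
  apply: (not_invariant_std_form L (x := ev R 1) (y := ev R 2)) => //.
  + exact: expm_35.
  + by move=> x y; exact: sl2C_sig (@sl2C_Bt35 R).
  + rewrite sig_B35 !evE//= [X in X != 0](_ : _ = 1) ?oner_eq0//; ring.
Qed.
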